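(* Let $\mathbb{F}_q$ be a finite field with $q$ elements and characteristic $p$, let $d\ge 2$ be a composite integer, let $l$ be the smallest prime divisor of $d$, let $D_d$ be the set of decomposable polynomials in $\mathbb{F}_q[x]$ of degree $d$, and set $$\alpha_d=\begin{cases}2q^{l+d/l}(1-q^{-1}) & \text{if } d\neq l^2,\\ q^{2l}(1-q^{-1}) & \text{if } d=l^2.\end{cases}$$ Then: (1) $q^{2\sqrt d}/2\le \alpha_d<2q^{d/2+2}$. (2) $\alpha_d/2\le \#D_d\le \alpha_d(1+q^{-d/(3l^2)})<2\alpha_d<4q^{d/2+2}$. (3) If $d\neq p^2$ and $q>5$, then $\#D_d\ge (3-2q^{-1})\alpha_d/4\ge q^{2\sqrt d}/2$. (4) Unless $p=l$ and $p$ divides $d$ exactly twice (i.e. $p^2\mid d$ and $p^3\nmid d$), we have $\#D_d\ge \alpha_d(1-2q^{-1})$. (5) If $p\nmid d$, then $|\#D_d-\alpha_d|\le \alpha_d\, q^{-d/(3l^2)}$.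
   Context: For polynomials $g,h\in F[x]$ over a field $F$, $g\circ h=g(h)$ denotes composition. A polynomial $f\in F[x]$ is decomposable if $f=g\circ h$ for some $g,h\in F[x]$ with $\deg g\ge 2$ and $\deg h\ge 2$. *)

(* Defs.v *)
From HB Require Import structures.
From mathcomp Require Import all_boot all_order all_algebra.
From mathcomp Require Import boolp reals exp.
Set Implicit Arguments. Unset Strict Implicit. Unset Printing Implicit Defensive.
Import Order.TTheory GRing.Theory Num.Theory.
Local Open Scope ring_scope.

Definition decomposable (F : fieldType) (f : {poly F}) : Prop :=
  exists g h : {poly F}, (3 <= size g)%N /\ (3 <= size h)%N /\ f = g \Po h.

Definition poly_of_coefs (F : fieldType) (n : nat) (c : {ffun 'I_n.+1 -> F}) : {poly F} :=
  \poly_(i < n.+1) c (inord i).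

(* D_d : decomposable polynomials of degree d, encoded injectively by their
   coefficient vectors (c_0, ..., c_d), with c_d <> 0. *)
Definition Dd (F : finFieldType) (d : nat) : {set {ffun 'I_d.+1 -> F}} :=
  [set c | (size (poly_of_coefs c) == d.+1) && `[< decomposable (poly_of_coefs c) >]].

Definition alpha (R : realType) (q d : nat) : R :=
  let l := pdiv d in
  if d == (l ^ 2)%N then (q%:R) ^+ (2 * l) * (1 - (q%:R)^-1)
  else 2 * (q%:R) ^+ (l + d %/ l) * (1 - (q%:R)^-1).

(* Main.v *)
Require Import Defs.
From HB Require Import structures.
From mathcomp Require Import all_boot all_order all_algebra.
From mathcomp Require Import boolp reals exp.
From mathcomp Require Import zify ring lra.
Set Implicit Arguments. Unset Strict Implicit. Unset Printing Implicit Defensive.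
Import Order.TTheory GRing.Theory Num.Theory.
Local Open Scope ring_scope.

(** A decomposable polynomial is a f + b for exactly one triple a <> 0, b, f with f
    a composition g o h of monic polynomials with zero constant term, so #D_d is
    q(q-1) times the number of such f.  Write d = l m.  The upper bound sums q^(k-1+d/k-1) over
    all divisors k of d; the outer degrees l and m dominate.  For the lower bound
    only outer degrees l and m matter, and three facts are needed:
    - composition with outer degree prime to p is injective, and for outer degree
      k divisible by p there are few collisions: given h <> h', the elements of
      F[h] and F[h'] in common have outer degree divisible by p, so that such an
      element is determined by the coefficients of g at multiples of p;
    - if p <> l, a polynomial with both outer degrees l and m is determined by few
      coefficients, since its approximate l-th root depends only on h and on the
      m/l leading coefficients of g;
    - if p = l < m, composition with outer degree p is injective on the pairs whose
      second leading coefficients are both nonzero, and comparing degrees in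
      f' = g'(h) h' shows that few or none of these values have outer degree m. *)

Ltac nat_only := repeat match goal with
  | H : ?T |- _ => lazymatch T with
    | nat => fail
    | is_true (leq _ _) => fail
    | @eq nat _ _ => fail
    | _ => clear H
    end
  end.
Ltac nlia := nat_only; lia.

(** * Uniqueness of compositions *)

Section PowerDifferences.
Variable F : fieldType.
Implicit Types (f g h r : {poly F}) (n k j : nat).

Lemma coefM_top f g a b :
  (size f <= a.+1)%N -> (size g <= b.+1)%N -> (f * g)`_(a + b) = f`_a * g`_b.
Proof.
move=> sf sg; have lta : (a < (a + b).+1)%N by lia.
rewrite coefM (bigD1 (Ordinal lta)) //= addKn big1 ?addr0 // => i.
rewrite -val_eqE /= neq_ltn => /orP[ia|ai].
  by rewrite [X in _ * X]nth_default ?mulr0 //; apply: leq_trans sg _; lia.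
by rewrite nth_default ?mul0r //; apply: leq_trans sf _; lia.
Qed.

Lemma size_mul_leS f g a b :
  (size f <= a.+1)%N -> (size g <= b.+1)%N -> (size (f * g)%R <= (a + b).+1)%N.
Proof.
move=> sf sg; apply: leq_trans (size_polyMleq _ _) _.
by have := leq_add sf sg; rewrite addSn addnS -ltnS; case: (_ + _)%N.
Qed.

Lemma size_monicX h n k : h \is monic -> size h = n.+1 ->
  size (h ^+ k) = (k * n).+1.
Proof.
move=> mh sh; have s0 : h ^+ k != 0 by rewrite monic_neq0 // monic_exp.
by rewrite -(prednK (n := size _)) ?size_poly_gt0 // size_exp sh mulnC.
Qed.

Lemma coef_monicX h n k : h \is monic -> size h = n.+1 -> (h ^+ k)`_(k * n) = 1.
Proof.
move=> mh sh; have /eqP := monic_exp k mh.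
by rewrite /lead_coef (size_monicX k mh sh).
Qed.

(** This sum is the cofactor of [h - h'] in [h ^+ k - h' ^+ k]. Each of its [k] products is monic of
    degree (k-1)n, so the top coefficient is [k], and the tame case is the one where [k] is nonzero
    in [F]. *)
Lemma sum_monicX h h' n k : h \is monic -> size h = n.+1 ->
  h' \is monic -> size h' = n.+1 ->
  let s := \sum_(i < k) h ^+ (k.-1 - i) * h' ^+ i in
  (size s <= (k.-1 * n).+1)%N /\ s`_(k.-1 * n) = k%:R.
Proof.
move=> mh sh mh' sh' /=.
have E (i : 'I_k) : (k.-1 * n = (k.-1 - i) * n + i * n)%N.
  by rewrite -mulnDl subnK //; case: i => /= i; lia.
split.
  apply: leq_trans (size_sum _ _ _) _; apply/bigmax_leqP => i _.
  by rewrite (E i) size_mul_leS ?(size_monicX _ mh sh) ?(size_monicX _ mh' sh').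
rewrite coef_sum (eq_bigr (fun=> 1)) ?sumr_const ?card_ord // => i _.
rewrite (E i) coefM_top ?(size_monicX _ mh sh) ?(size_monicX _ mh' sh') //.
by rewrite !coef_monicX ?mulr1.
Qed.

Lemma monicX_sub h h' n k j : h \is monic -> size h = n.+1 ->
  h' \is monic -> size h' = n.+1 -> (size (h - h')%R <= j.+1)%N ->
  (size (h ^+ k - h' ^+ k)%R <= (j + k.-1 * n).+1)%N /\
  (h ^+ k - h' ^+ k)`_(j + k.-1 * n) = (h - h')`_j * k%:R.
Proof.
move=> mh sh mh' sh' su.
have [ss cs] := sum_monicX k mh sh mh' sh'.
rewrite subrXX; split; last by rewrite coefM_top // cs.
exact: size_mul_leS.
Qed.

Definition lower g k := g - g`_k *: 'X^k.

Lemma size_lower g k : (size g <= k.+1)%N -> (size (lower g k) <= k)%N.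
Proof.
move=> sg; apply/leq_sizeP => i; rewrite /lower coefB coefZ coefXn.
rewrite leq_eqVlt => /orP[/eqP <-|ki]; first by rewrite eqxx mulr1 subrr.
by rewrite (gtn_eqF ki) mulr0 subr0 nth_default // (leq_trans sg ki).
Qed.

Lemma comp_lower g h k : g \Po h = g`_k *: h ^+ k + (lower g k \Po h).
Proof. by rewrite /lower comp_polyB comp_polyZ comp_Xn_poly addrC subrK. Qed.

Lemma size_comp_lt r h n k : size h = n.+1 -> (size r <= k)%N ->
  (size (r \Po h) <= (k.-1 * n).+1)%N.
Proof.
move=> sh sr; apply: leq_trans (size_comp_poly_leq _ _) _.
by rewrite sh /= ltnS leq_mul // -!subn1 leq_sub2r.
Qed.

Lemma comp_poly_inj h : (1 < size h)%N -> injective (fun g => g \Po h).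
Proof.
move=> sh g g' /eqP; rewrite -subr_eq0 -comp_polyB comp_poly_eq0 // subr_eq0.
by move/eqP.
Qed.

Lemma degree_sub f g : f`_0 = g`_0 -> f != g ->
  exists j, [/\ (0 < j)%N, size (f - g) = j.+1 & (f - g)`_j != 0].
Proof.
move=> E ne; have nz : f - g != 0 by rewrite subr_eq0.
exists (size (f - g)).-1; split; last by rewrite -lead_coefE lead_coef_eq0.
  rewrite lt0n; apply: contra nz => /eqP s1.
  have /size1_polyC -> : (size (f - g)%R <= 1)%N by rewrite -s1 leqSpred.
  by rewrite coefB E subrr.
by rewrite prednK // size_poly_gt0.
Qed.

(** If [h] and [h'] differed, with j = deg(h - h') > 0 as the constant terms agree, the top powers
    would differ at degree j + (k-1)n by a nonzero multiple of [k], while the lower terms of [g] and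
    [g'] reach only degree (k-1)n. The outer polynomials may have any leading coefficient, so that
    differences of monic ones are covered. *)
Lemma tame_inner_uniq g g' h h' n :
  (0 < n)%N -> h \is monic -> size h = n.+1 -> h' \is monic -> size h' = n.+1 ->
  h`_0 = h'`_0 -> ((size g).-1)%:R != 0 :> F -> g \Po h = g' \Po h' -> h = h'.
Proof.
move=> n0 mh sh mh' sh' e0 k0 E; apply/eqP/negPn/negP => ne.
set k := (size g).-1 in k0.
have sg : (size g = k.+1)%N.
  rewrite /k prednK //; case: (posnP (size g)) k0 => // s0.
  by rewrite /k s0 eqxx.
have k1 : (0 < k)%N by case: (k) k0 => //; rewrite eqxx.
have sg' : size g' = k.+1.
  have := congr1 (fun f => (size f).-1) E; rewrite !size_comp_poly sh sh' sg /=.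
  move/eqP; rewrite eqn_mul2r -[n == _]negbK -lt0n n0 /= => /eqP kE.
  by move: k1; rewrite kE; case: (size g').
have lE : g`_k = g'`_k.
  have := congr1 (@lead_coef F) E; rewrite !lead_coef_comp ?sh ?sh' //.
  by rewrite (eqP mh) (eqP mh') !expr1n !mulr1 /lead_coef sg sg'.
have l0 : g`_k != 0.
  by have := lead_coef_eq0 g; rewrite /lead_coef sg /= -size_poly_eq0 sg => ->.
have [j [j1 sj uj]] := degree_sub e0 ne.
have [_ cE] := monicX_sub k mh sh mh' sh' (eq_leq sj).
move: E; rewrite (comp_lower g h k) (comp_lower g' h' k) -lE => E.
have {}E : g`_k *: (h ^+ k - h' ^+ k) = (lower g' k \Po h') - (lower g k \Po h).
  apply/eqP; rewrite scalerBr subr_eq addrAC eq_sym subr_eq addrC eq_sym.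
  by rewrite [_ + (lower g k \Po h)]E.
have := congr1 (fun f : {poly F} => f`_(j + k.-1 * n)) E.
rewrite /= coefZ cE [RHS]coefB.
rewrite (nth_default _ (leq_trans (size_comp_lt sh (size_lower _)) _)) ?sg //; last by lia.
rewrite (nth_default _ (leq_trans (size_comp_lt sh' (size_lower _)) _)) ?sg' //; last by lia.
by move/eqP; rewrite subrr !mulf_eq0 (negPf l0) (negPf k0) (negPf uj).
Qed.

(** Monic original polynomials: the normal forms under composition with affine maps on the left. *)
Definition monorig n f := [&& f \is monic, size f == n.+1 & f`_0 == 0].

Lemma monorigP n f : reflect [/\ f \is monic, size f = n.+1 & f`_0 = 0] (monorig n f).
Proof. by apply: (iffP and3P) => -[? /eqP? /eqP?]; split=> //; apply/eqP. Qed.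

Lemma monorig_coefn n f : monorig n f -> f`_n = 1.
Proof. by case/monorigP => /eqP + sf _; rewrite /lead_coef sf. Qed.

Lemma tame_uniq k n g g' h h' : (0 < n)%N -> k%:R != 0 :> F ->
  monorig k g -> monorig n h -> monorig n h' ->
  g \Po h = g' \Po h' -> g = g' /\ h = h'.
Proof.
move=> n0 k0 /monorigP[_ sg _] /monorigP[mh sh h0] /monorigP[mh' sh' h0'] E.
have hh : h = h'.
  by apply: (tame_inner_uniq n0 mh sh mh' sh' _ _ E); rewrite ?h0 ?h0' ?sg.
by split=> //; move: E; rewrite -hh; apply: comp_poly_inj; rewrite sh.
Qed.

Lemma monorig_comp k n g h : (0 < n)%N -> monorig k g -> monorig n h ->
  monorig (k * n) (g \Po h).
Proof.
move=> n0 /monorigP[mg sg g0] /monorigP[mh sh h0]; apply/monorigP; split.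
- by apply/eqP; rewrite lead_coef_comp ?sh // (eqP mg) (eqP mh) expr1n mulr1.
- rewrite -(prednK (n := size _)) ?size_comp_poly ?sg ?sh //.
  by rewrite size_poly_gt0 comp_poly_eq0 ?sh // -size_poly_eq0 sg.
- by rewrite -horner_coef0 horner_comp (horner_coef0 h) h0 horner_coef0.
Qed.

Lemma monorig_sub_size n f g : monorig n f -> monorig n g -> (size (f - g)%R <= n)%N.
Proof.
move=> mf mg; apply/leq_sizeP => i; rewrite coefB leq_eqVlt => /orP[/eqP<-|ni].
  by rewrite !monorig_coefn // subrr.
case/monorigP: mf => _ sf _; case/monorigP: mg => _ sg _.
by rewrite !nth_default ?subrr ?sf ?sg.
Qed.

(* Otherwise g1 - g2 would have degree prime to p and (g1 - g2) o h would lie in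
   F[h'], contradicting the tame case. *)
Lemma collision_determined k n p (chp : p \in [pchar F]) h h' g1 g1' g2 g2' :
  (0 < n)%N -> monorig n h -> monorig n h' -> h != h' ->
  monorig k g1 -> monorig k g2 ->
  g1 \Po h = g1' \Po h' -> g2 \Po h = g2' \Po h' ->
  (forall i, (0 < i < k)%N -> (p %| i)%N -> g1`_i = g2`_i) -> g1 = g2.
Proof.
move=> n0 /monorigP[mh sh h0] /monorigP[mh' sh' h0'] ne mg1 mg2 E1 E2 C.
apply/eqP/negPn/negP => ng.
have z : g1`_0 = g2`_0.
  by case/monorigP: mg1 => _ _ ->; case/monorigP: mg2 => _ _ ->.
have [j [j1 sj uj]] := degree_sub z ng.
have jk : (j < k)%N by rewrite -sj monorig_sub_size.
move/eqP: ne; apply.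
apply: (@tame_inner_uniq (g1 - g2) (g1' - g2') _ _ _ n0 mh sh mh' sh').
- by rewrite h0 h0'.
- rewrite -(dvdn_pcharf chp) sj /=; apply: contra uj => pj.
  by rewrite coefB C ?subrr // j1.
- by rewrite !comp_polyB E1 E2.
Qed.

(* The polynomial part of the l-th root of f, hence H, is read off from the
   coefficients of f in degrees > (l-1)m, and these depend only on h and the
   m/l leading coefficients of g. *)
Lemma two_sided_determined l m t h g1 g2 G1 G2 H1 H2 :
  (1 < l)%N -> (t < m)%N -> (m < l * t.+1)%N -> l%:R != 0 :> F ->
  monorig l h -> monorig m g1 -> monorig m g2 ->
  monorig l G1 -> monorig l G2 -> monorig m H1 -> monorig m H2 ->
  g1 \Po h = G1 \Po H1 -> g2 \Po h = G2 \Po H2 ->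
  (forall i, (m - t <= i)%N -> g1`_i = g2`_i) ->
  (forall i, (0 < i < l.-1)%N -> G1`_i = G2`_i) ->
  g1 \Po h = g2 \Po h.
Proof.
move=> l1 tm mlt l0 mh mg1 mg2 mG1 mG2 mH1 mH2 E1 E2 Cg CG.
case/monorigP: (mh) => _ sh _.
(* [g1 - g2] has degree at most m-t-1, and l(m-t-1) < (l-1)m because m < l(t+1). *)
have sd : (size ((g1 \Po h) - (g2 \Po h))%R <= l.-1 * m)%N.
  rewrite -comp_polyB.
  have sg : (size (g1 - g2)%R <= m - t)%N.
    by apply/leq_sizeP => i /Cg; rewrite coefB => ->; rewrite subrr.
  apply: leq_trans (size_comp_lt sh sg) _.
  by nia.
case/monorigP: (mH1) => m1 s1 z1; case/monorigP: (mH2) => m2 s2 z2.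
have sG1 : size G1 = l.+1 by case/monorigP: mG1.
have sG2 : size G2 = l.+1 by case/monorigP: mG2.
have HH : H1 = H2.
  apply/eqP/negPn/negP => ne.
  have [j [j1 sj uj]] := degree_sub (etrans z1 (esym z2)) ne.
  have [_ cE] := monicX_sub l m1 s1 m2 s2 (eq_leq sj).
  have := congr1 (fun f : {poly F} => f`_(j + l.-1 * m)) (erefl ((g1 \Po h) - (g2 \Po h))).
  rewrite {1}(nth_default _ (leq_trans sd _)); last by nlia.
  rewrite E1 E2 (comp_lower G1 H1 l) (comp_lower G2 H2 l).
  rewrite (monorig_coefn mG1) (monorig_coefn mG2) !scale1r.
  rewrite opprD addrACA coefD cE [X in _ + X]coefB.
  rewrite (nth_default _ (leq_trans (size_comp_lt s1 (size_lower _)) _)) ?sG1 //; last by nlia.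
  rewrite (nth_default _ (leq_trans (size_comp_lt s2 (size_lower _)) _)) ?sG2 //; last by nlia.
  by rewrite subrr addr0 => /esym/eqP; rewrite mulf_eq0 (negPf l0) (negPf uj).
(* Only the coefficients at l-1 may still differ; their difference is the coefficient of the whole
   difference at degree (l-1)m, which vanishes by [sd]. *)
have GG : G1 - G2 = (G1`_l.-1 - G2`_l.-1) *: 'X^(l.-1).
  apply/polyP => i; rewrite coefB coefZ coefXn.
  have [->|ne] := eqVneq i l.-1; first by rewrite mulr1.
  rewrite mulr0; apply/eqP; rewrite subr_eq0; apply/eqP.
  have [il|il] := ltnP i l.-1.
    case: (posnP i) => [->|i0]; last by apply: CG; rewrite i0.
    by case/monorigP: mG1 => _ _ ->; case/monorigP: mG2 => _ _ ->.
  have [->|ne'] := eqVneq i l; first by rewrite !monorig_coefn.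
  have li : (l < i)%N.
    by rewrite ltn_neqAle eq_sym ne' -(prednK (ltnW l1)) ltn_neqAle eq_sym ne.
  by rewrite !nth_default // ?sG1 ?sG2.
have D : (g1 \Po h) - (g2 \Po h) = (G1`_l.-1 - G2`_l.-1) *: H1 ^+ l.-1.
  by rewrite E1 E2 -HH -comp_polyB GG comp_polyZ comp_Xn_poly.
have := congr1 (fun f : {poly F} => f`_(l.-1 * m)) D.
rewrite nth_default // coefZ (coef_monicX _ m1 s1) mulr1 => z.
by apply/eqP; rewrite -subr_eq0 D -z scale0r.
Qed.

End PowerDifferences.

(** * Compositions whose outer degree is the characteristic *)

Section OuterDegreeCharacteristic.
Variables (F : fieldType) (p : nat).
Hypothesis chp : p \in [pchar F].
Implicit Types (f g h r : {poly F}) (n k j m : nat).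


Lemma natr_neq0 n : (n%:R != 0 :> F) = ~~ (p %| n)%N.
Proof. by rewrite (dvdn_pcharf chp). Qed.

(** The derivative of [f ^+ p] is zero, so every coefficient times its index vanishes. *)
Lemma coef_expp f i : ~~ (p %| i)%N -> (f ^+ p)`_i = 0.
Proof.
case: i => [|i pi]; first by rewrite dvdn0.
have := coef_deriv (f ^+ p) i; rewrite deriv_exp -mulr_natr.
have -> : p%:R = 0 :> {poly F} by rewrite -polyC_natr (pcharf0 chp).
rewrite mulr0 coef0 -mulr_natr => /esym/eqP.
by rewrite mulf_eq0 (negPf (_ : _%:R != 0)) ?orbF ?natr_neq0 // => /eqP.
Qed.

Lemma expp_sub f g : (f - g) ^+ p = f ^+ p - g ^+ p.
Proof.
have ch : p \in [pchar {poly F}] by rewrite pchar_poly.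
by rewrite -!(pFrobenius_autE ch) pFrobenius_autB_comm //; apply: mulrC.
Qed.

(** This is [monicX_sub] with ['X^n] in place of [h'] and j = n-1; neither ['X^n] nor its [k]-th
    power has a term at the degrees concerned. *)
Lemma coef_monicX_second h n k : h \is monic -> size h = n.+1 ->
  (0 < n)%N -> (0 < k)%N -> (h ^+ k)`_(n.-1 + k.-1 * n) = h`_(n.-1) * k%:R.
Proof.
move=> mh sh n0 k0.
have su : (size (h - 'X^n)%R <= n.-1.+1)%N.
  rewrite prednK //; apply/leq_sizeP => i; rewrite coefB coefXn leq_eqVlt.
  case/orP=> [/eqP<-|ni]; last by rewrite (gtn_eqF ni) nth_default ?subr0 // sh.
  by rewrite eqxx; move/eqP: mh; rewrite /lead_coef sh /= => ->; rewrite subrr.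
have [_] := monicX_sub k mh sh (monicXn _ n) (size_polyXn _ n) su.
rewrite !coefB -exprM !coefXn.
have /negPf -> : (n.-1 + k.-1 * n != n * k)%N by rewrite -{2}(prednK k0) mulnS mulnC; nlia.
have /negPf -> : (n.-1 != n)%N by nlia.
by rewrite !subr0.
Qed.

(** Put u = h - h', of degree j. Since p-th powers are additive, [u ^+ p] is a difference of
    compositions with outer degree below p. Once the coefficients of [g] and [g'] at p-1 are known
    to agree, that difference has degree exactly j + (p-2)m, so j(p-1) = (p-2)m. This contradicts j
    > 0 if p = 2, and parity if p and m are odd. *)
Lemma wild_uniq m g g' h h' : (p < m)%N -> (odd p -> odd m) ->
  monorig p g -> monorig p g' -> monorig m h -> monorig m h' ->
  g`_p.-1 != 0 -> h`_m.-1 != 0 -> g \Po h = g' \Po h' -> g = g' /\ h = h'.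
Proof.
have p_prime := pcharf_prime chp; have p_gt1 := prime_gt1 p_prime.
move=> pm oddpm mg mg' mh mh' c0 b0 E.
suff hh : h = h'.
  split=> //; move: E; rewrite -hh; apply: comp_poly_inj.
  by case/monorigP: mh => _ -> _; nlia.
apply/eqP/negPn/negP => ne.
case/monorigP: (mg) => _ sg _; case/monorigP: (mg') => _ sg' _.
case/monorigP: (mh) => hm sh h0; case/monorigP: (mh') => hm' sh' h0'.
have [j [j1 sj uj]] := degree_sub (etrans h0 (esym h0')) ne.
set u := h - h' in sj uj.
have p1 : (p.-1 < p)%N by nlia.
set r := lower g p; set r' := lower g' p.
have sr : (size r <= p)%N by rewrite size_lower ?sg.
have sr' : (size r' <= p)%N by rewrite size_lower ?sg'.
have rc : r`_p.-1 = g`_p.-1.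
 by rewrite /r /lower coefB coefZ coefXn (ltn_eqF p1) mulr0 subr0.
have rc' : r'`_p.-1 = g'`_p.-1.
 by rewrite /r' /lower coefB coefZ coefXn (ltn_eqF p1) mulr0 subr0.
have {}E : u ^+ p = (r' \Po h') - (r \Po h).
  move: E; rewrite (comp_lower g h p) (comp_lower g' h' p) -/r -/r'.
  rewrite (monorig_coefn mg) (monorig_coefn mg') !scale1r expp_sub => E.
  by apply/eqP; rewrite subr_eq addrAC eq_sym subr_eq eq_sym E addrC.
clearbody r r'.
have up : (u ^+ p)`_(j * p) != 0.
  have -> : (j * p)%N = (size (u ^+ p)).-1 by rewrite size_exp sj.
  by rewrite -lead_coefE lead_coef_exp expf_neq0 // lead_coefE sj.
have jm : (j * p <= p.-1 * m)%N.
  rewrite leqNgt; apply/negP => lt; move/eqP: up; apply.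
  by rewrite E coefB !nth_default ?subr0 ?(leq_trans (size_comp_lt _ _) lt).
(* From jp <= (p-1)m and p < m; hence [h] and [h'] share their second coefficient. *)
have jm1 : (j < m.-1)%N by nat_only; nia.
have hh1 : h`_m.-1 = h'`_m.-1.
  by apply/eqP; rewrite -subr_eq0 -coefB nth_default // sj.
have sr2 : (size (lower r p.-1) <= p.-1)%N by rewrite size_lower // prednK //; nlia.
have sr2' : (size (lower r' p.-1) <= p.-1)%N by rewrite size_lower // prednK //; nlia.
have rE f : r \Po f = g`_p.-1 *: f ^+ p.-1 + (lower r p.-1 \Po f).
  by rewrite (comp_lower r f p.-1) rc.
have rE' f : r' \Po f = g'`_p.-1 *: f ^+ p.-1 + (lower r' p.-1 \Po f).
  by rewrite (comp_lower r' f p.-1) rc'.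
move: (lower r p.-1) (lower r' p.-1) sr2 sr2' rE rE' => r2 r2' sr2 sr2' rE rE'.
have small i f (s : {poly F}) : size f = m.+1 -> (0 < i)%N -> (size s <= p.-1)%N ->
    (s \Po f)`_(i + p.-2 * m) = 0.
  move=> sf i0 sk; rewrite nth_default //.
  by apply: leq_trans (size_comp_lt sf sk) _; nlia.
have p1n : (p.-1)%:R != 0 :> F by rewrite natr_neq0 gtnNdvd //; nlia.
(* Only multiples of p occur as degrees in [u ^+ p]. If p divides m, the degree (p-1)m - 1 is not a
   multiple of p; otherwise (p-1)m is not. The right-hand side must vanish there. *)
have cc : g`_p.-1 = g'`_p.-1.
  have [pdm|npdm] := boolP (p %| m)%N.
    have := congr1 (fun f : {poly F} => f`_(m.-1 + p.-2 * m)) E.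
    rewrite /= coef_expp; last first.
      have e : (p.-1 * m = (m.-1 + p.-2 * m).+1)%N.
        by case: (p) p_gt1 => [|[|p']] //; case: (m) pm => // m' _ _ /=; nlia.
      apply/negP => pd; have : (p %| (m.-1 + p.-2 * m).+1)%N by rewrite -e dvdn_mull.
      by rewrite -addn1 dvdn_addr // dvdn1; nlia.
    rewrite coefB rE rE' !coefD !coefZ.
    rewrite !small //; try nlia.
    rewrite !(@coef_monicX_second _ m p.-1) //; try nlia.
    rewrite !addr0 -hh1 -mulrBl => /esym/eqP.
    by rewrite !mulf_eq0 (negPf b0) (negPf p1n) !orbF subr_eq0 => /eqP.
  have := congr1 (fun f : {poly F} => f`_(p.-1 * m)) E.
  rewrite /= coef_expp; last by rewrite Euclid_dvdM // negb_or npdm gtnNdvd //; nlia.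
  have e : (p.-1 * m = m + p.-2 * m)%N by rewrite -mulSn prednK //; nlia.
  rewrite coefB rE rE' !coefD !coefZ.
  have small0 f (s : {poly F}) : size f = m.+1 -> (size s <= p.-1)%N ->
      (s \Po f)`_(p.-1 * m) = 0.
    by move=> sf ss; rewrite e small //; nlia.
  rewrite (small0 _ _ sh' sr2') (small0 _ _ sh sr2).
  rewrite !coef_monicX // !mulr1 !addr0 => /esym/eqP.
  by rewrite subr_eq0 => /eqP.
have [sd cd] := monicX_sub p.-1 hm sh hm' sh' (eq_leq sj).
have EE : u ^+ p = - (g`_p.-1 *: (h ^+ p.-1 - h' ^+ p.-1)) +
    ((r2' \Po h') - (r2 \Po h)).
  rewrite E rE rE' -cc.
  by rewrite scalerBr opprB opprD addrACA.
have cne : (u ^+ p)`_(j + p.-2 * m) != 0.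
  rewrite EE coefD coefN coefZ cd [X in _ + X]coefB !small // subrr addr0 oppr_eq0.
  by rewrite !mulf_neq0.
have e1 : (j + p.-2 * m <= j * p)%N.
  rewrite leqNgt; apply: contra cne => lt; rewrite nth_default //.
  by have := size_exp u p; rewrite sj /=; case: (size _) => //= ? ->.
have e2 : (j * p <= j + p.-2 * m)%N.
  rewrite leqNgt; apply: contra up => lt; rewrite EE coefD coefN coefZ [X in _ + X]coefB.
  rewrite (nth_default _ (leq_trans sd lt)) mulr0 oppr0 add0r.
  have lt' : (p.-2 * m < j * p)%N by apply: leq_ltn_trans lt; apply: leq_addl.
  rewrite (nth_default _ (leq_trans (size_comp_lt sh sr2) lt')).
  by rewrite (nth_default _ (leq_trans (size_comp_lt sh' sr2') lt')) subrr.
have {e1 e2} e : (j * p.-1 = p.-2 * m)%N.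
  by have := prednK (ltnW p_gt1); nat_only; nia.
have [p2|podd] := even_prime p_prime; first by move: e; rewrite p2 /=; nlia.
have := congr1 odd e; rewrite !oddM oddpm // andbT.
have -> : odd p.-1 = false by move: podd p_gt1; case: (p) => //= ? /negPf.
have -> : odd p.-2 by move: podd p_gt1; case: (p) => [|[|?]] //=; rewrite negbK.
by rewrite andbF.
Qed.

Lemma size_deriv_ge f i : (i.+1)%:R * f`_i.+1 != 0 -> (i < size f^`())%N.
Proof.
move=> ne; rewrite ltnNge; apply: contra ne => le.
by rewrite mulr_natl -coef_deriv nth_default.
Qed.

(* Compare degrees in f' = g'(h) h' = g2'(h2) h2'. *)
Lemma wild_two_sided m g h g2 h2 : (p < m)%N ->
  monorig p g -> monorig m h -> g`_p.-1 != 0 -> h`_m.-1 != 0 ->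
  monorig m g2 -> monorig p h2 -> g \Po h = g2 \Po h2 ->
  [/\ (p %| m)%N, ~~ (p %| m %/ p)%N, g2`_m.-1 = 0, g2`_(m - m %/ p) != 0
    & h2`_p.-1 != 0].
Proof.
have p_prime := pcharf_prime chp; have p_gt1 := prime_gt1 p_prime.
move=> pm mg mh c0 b0 mg2 mh2 E.
case/monorigP: (mg) => _ sg _; case/monorigP: (mg2) => _ sg2 _.
case/monorigP: (mh) => _ sh _; case/monorigP: (mh2) => _ sh2 _.
have p1n : (p.-1)%:R != 0 :> F by rewrite natr_neq0 gtnNdvd //; nlia.
have der_small f : monorig p f -> (size f^`() <= p.-1)%N.
  move=> mf; case/monorigP: (mf) => _ sf _; apply/leq_sizeP => i.
  rewrite leq_eqVlt coef_deriv -mulr_natl => /orP[/eqP<-|lt].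
    by rewrite prednK ?(pcharf0 chp) ?mul0r //; nlia.
  by rewrite nth_default ?mulr0 // sf; nlia.
have sdg : size g^`() = p.-1.
  apply/eqP; rewrite eqn_leq der_small //=.
  have := @size_deriv_ge g p.-2; rewrite !prednK; try nlia.
  by apply; rewrite mulf_neq0.
have b1n : ~~ (p %| m)%N || ((m.-1)%:R != 0 :> F).
  case: (boolP (p %| m)%N) => //= pdm; rewrite natr_neq0.
  apply/negP => pd; have : (p %| m.-1.+1)%N by rewrite prednK //; nlia.
  by rewrite -addn1 dvdn_addr // dvdn1; nlia.
(* If p divides m, the derivative kills the leading term of [h], and the term coming from the
   nonzero coefficient at m-1 takes its place. *)
have sdh : size h^`() = (m - (p %| m)%N)%N.
  case: (boolP (p %| m)%N) b1n => /= pdm m1n.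
    apply/eqP; rewrite eqn_leq; apply/andP; split.
      apply/leq_sizeP => i; rewrite leq_eqVlt coef_deriv -mulr_natl => /orP[/eqP<-|lt].
        rewrite subn1 prednK; last by nlia.
        by move: pdm; rewrite (dvdn_pcharf chp) => /eqP ->; rewrite mul0r.
      by rewrite nth_default ?mulr0 // sh; nlia.
    have := @size_deriv_ge h m.-2; rewrite !prednK; try nlia.
    by rewrite subn1; apply; rewrite mulf_neq0.
  rewrite subn0; apply/eqP; rewrite eqn_leq; apply/andP; split.
    by rewrite -ltnS -sh lt_size_deriv // -size_poly_eq0 sh.
  have := @size_deriv_ge h m.-1; rewrite !prednK; try nlia.
  by apply; rewrite mulf_neq0 ?natr_neq0 // (monorig_coefn mh) oner_eq0.
have D := congr1 (fun f : {poly F} => f^`()) E.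
rewrite /= !deriv_comp in D.
have sA : (size (g^`() \Po h)).-1 = (p.-2 * m)%N by rewrite size_comp_poly sdg sh.
have g'0 : g^`() != 0 by rewrite -size_poly_eq0 sdg; nlia.
have A0 : g^`() \Po h != 0 by rewrite comp_poly_eq0 // sh; nlia.
have B0 : h^`() != 0 by rewrite -size_poly_eq0 sdh; case: (p %| m)%N; nlia.
have /eqP := D; have := mulf_neq0 A0 B0; rewrite D => ne0 _.
have [C0 D0] : g2^`() \Po h2 != 0 /\ h2^`() != 0.
  by apply/andP; rewrite -negb_or -mulf_eq0.
have G0 : g2^`() != 0 by apply: contra C0 => /eqP ->; rewrite comp_poly0.
have S := congr1 (fun f : {poly F} => size f) D.
rewrite /= !size_mul // in S.
have sC : (size (g2^`() \Po h2)).-1 = ((size g2^`()).-1 * p)%N by rewrite size_comp_poly sh2.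
have A1 : size (g^`() \Po h) = (p.-2 * m).+1 by rewrite -sA prednK // size_poly_gt0.
have C1 : size (g2^`() \Po h2) = ((size g2^`()).-1 * p).+1.
  by rewrite -sC prednK // size_poly_gt0.
rewrite A1 C1 !addSn /= sdh in S.
have dh2 := der_small _ mh2.
have dh2g : (0 < size h2^`())%N by rewrite size_poly_gt0.
have dg2g : (0 < size g2^`())%N by rewrite size_poly_gt0.
set a := size g2^`() in S dg2g *; set b := size h2^`() in S dh2 dh2g *.
have aE : g2^`()`_a.-1 != 0 by rewrite -lead_coefE lead_coef_eq0.
have bE : h2^`()`_b.-1 != 0 by rewrite -lead_coefE lead_coef_eq0.
(* If p does not divide m, then a >= m, and (m-1)p + b exceeds (p-1)m because p < m. *)
case: (boolP (p %| m)%N) b1n S => /= pdm m1n S; last first.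
  have am : (m <= a)%N.
    have := @size_deriv_ge g2 m.-1; rewrite !prednK; try nlia.
    by apply; rewrite mulf_neq0 ?natr_neq0 // (monorig_coefn mg2) oner_eq0.
  have : (m.-1 * p <= a.-1 * p)%N by rewrite leq_mul2r; apply/orP; right; nlia.
  have e : (p.-2 * m + m = p * m - m)%N.
    rewrite -mulSnr prednK; last by nlia.
    by rewrite -{2}(prednK (ltnW p_gt1)) mulSn addKn.
  have le : (m * 1 <= p * m)%N by rewrite mulnC leq_mul // ltnW.
  move: S; rewrite subn0 e -(subn1 m) mulnBl mul1n (mulnC m p).
  by move: le; rewrite muln1; nlia.
have := divnK pdm; set t := (m %/ p)%N => tE.
have t1 : (1 < t)%N by move: pm; rewrite -tE -{1}(mul1n p) ltn_pmul2r // ltnW.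
(* With one added, the degree equation shows that p divides b+1. As 0 < b < p, this forces b = p-1,
   and then a = (p-1)t = m-t. The leading coefficients [aE] and [bE] now give the nonvanishing
   claims. *)
have e : ((a.-1 * p + b).+1 = (p.-1 * t) * p)%N.
  rewrite -S subn1 -addnS prednK; last by nlia.
  by rewrite -mulSnr prednK -?tE ?mulnA //; nlia.
have bp : b = p.-1.
  have pd : (p %| b.+1)%N.
    have : (p %| (a.-1 * p + b).+1)%N by rewrite e dvdn_mull.
    by rewrite -addnS dvdn_addr // dvdn_mull.
  have := dvdn_leq (ltn0Sn _) pd; nlia.
have at_ : a = (p.-1 * t)%N.
  have {e}e : (a * p = (p.-1 * t) * p)%N.
    by rewrite -e bp -addnS prednK; [rewrite -{1}(prednK dg2g) mulSn addnC | nlia].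
  by apply/eqP; move/eqP: e; rewrite eqn_mul2r; case/orP => [/eqP|]; nlia.
have mt : (m - t = a)%N by rewrite at_ -tE mulnC -{1}(prednK (ltnW p_gt1)) mulSnr addnK.
rewrite mt.
move: aE; rewrite coef_deriv prednK // -mulr_natl mulf_eq0 negb_or natr_neq0 => /andP[pa ->].
move: bE; rewrite bp coef_deriv prednK; last by nlia.
rewrite -mulr_natl mulf_eq0 negb_or => /andP[_ ->].
split => //; first by apply: contra pa; rewrite at_; apply: dvdn_mull.
(* Because t >= 2, the derivative of [g2] has no term of degree m-2, whose coefficient is m-1 times
   that of [g2] at m-1. *)
have am : (a <= m.-2)%N by rewrite -mt -subn2 leq_sub2l.
have : g2^`()`_m.-2 = 0 by rewrite nth_default.
rewrite coef_deriv prednK; last by move: pm p_gt1; clear; lia.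
by rewrite -mulr_natl => /eqP; rewrite mulf_eq0 (negPf m1n) => /eqP.
Qed.

End OuterDegreeCharacteristic.

(** * Counting monic original compositions *)

Section FiniteCounting.
Variables A B : finType.

(** Choose a representative [rep x] in each fibre. Every element x that is not a representative
    yields two ordered collisions, (x, rep x) and (rep x, x); hence the factor 2. *)
Lemma card_collisions (f : A -> B) (S : {set A}) :
  (2 * #|S| <= 2 * #|f @: S| +
    #|[set xy : A * A | [&& xy.1 \in S, xy.2 \in S, xy.1 != xy.2 & f xy.1 == f xy.2]]|)%N.
Proof.
set coll := [set xy : A * A | _].
pose rep x := odflt x [pick y in S | f y == f x].
have repP x : x \in S -> (rep x \in S) /\ f (rep x) = f x.
  move=> xS; rewrite /rep; case: pickP => [y /andP[yS /eqP]|/(_ x)] //=.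
have repE x y : x \in S -> y \in S -> f x = f y -> rep x = rep y.
  move=> xS yS e; rewrite /rep e.
  by case: pickP => // /(_ y); rewrite yS eqxx.
pose R := [set x in S | rep x == x]; pose N := [set x in S | rep x != x].
have cS : #|S| = (#|R| + #|N|)%N.
  rewrite -(cardsID R S); congr (_ + _)%N; apply: eq_card => x; rewrite !inE.
    by rewrite andbA andbb.
  by rewrite negb_and andbC; case: (x \in S).
have cR : (#|R| <= #|f @: S|)%N.
  have <- : #|f @: R| = #|R|.
    apply: card_in_imset => x y; rewrite !inE => /andP[xS /eqP rx] /andP[yS /eqP ry] e.
    by rewrite -rx -ry; apply: repE.
  by apply: subset_leq_card; apply: imsetS; apply/subsetP => x; rewrite inE => /andP[].
pose A1 := (fun x => (x, rep x)) @: N; pose A2 := (fun x => (rep x, x)) @: N.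
have c1 : #|A1| = #|N| by apply: card_imset => x y [].
have c2 : #|A2| = #|N| by apply: card_imset => x y [].
have dis : A1 :&: A2 = set0.
  apply/setP => -[a b]; rewrite !inE; apply/negP => /andP[].
  case/imsetP => x; rewrite inE => /andP[xS nx] [-> ->].
  case/imsetP => y; rewrite inE => /andP[yS ny] [ex ey].
  case/repP: (yS) => rS rE; move/eqP: nx; apply.
  by rewrite {2}ex; apply: repE => //; rewrite ex.
have sub : A1 :|: A2 \subset coll.
  apply/subsetP => ab; rewrite inE => /orP[] /imsetP[x];
    rewrite inE => /andP[xS nx] ->; case/repP: (xS) => rS rE; rewrite inE /= xS rS rE eqxx.
    by rewrite eq_sym nx.
  by rewrite nx.
have := subset_leq_card sub; have := cardsUI A1 A2.
by rewrite dis cards0 c1 c2; lia.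
Qed.

(** For encodings that depend on chosen witnesses: [r a b] says that [b] is a possible code of [a],
    and choice selects one code for each [a]. *)
Lemma leq_card_rel (S : {set A}) (r : A -> B -> Prop) :
  (forall a, a \in S -> exists b, r a b) ->
  (forall a a' b, a \in S -> a' \in S -> r a b -> r a' b -> a = a') ->
  (#|S| <= #|B|)%N.
Proof.
move=> ex uniq.
have [f fP] : exists f : A -> option B,
    forall a, a \in S -> exists2 b, f a = Some b & r a b.
  apply: (@fin_all_exists A (fun=> option B)
            (fun a o => a \in S -> exists2 b, o = Some b & r a b)) => a.
  have [aS|aS] := boolP (a \in S); last by exists None.
  by case: (ex a aS) => b rb; exists (Some b) => _; exists b.
have -> : #|S| = #|f @: S|.
  apply/esym/card_in_imset => a a' aS aS' e.
  case: (fP a aS) (fP a' aS') => b eb rb [b' eb' rb'].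
  by move: e; rewrite eb eb' => -[e]; apply: (uniq a a' b) => //; rewrite e.
have -> : #|B| = #|Some @: [set: B]| by rewrite card_imset ?cardsT // => b b' [].
apply: subset_leq_card; apply/subsetP => o /imsetP[a aS ->].
by case: (fP a aS) => b -> _; apply: imset_f; rewrite inE.
Qed.

End FiniteCounting.

(** * Monic original polynomials as coefficient vectors *)

Section MonicOriginal.
Variable F : finFieldType.
Local Notation q := #|F|.
Implicit Types (n k d : nat).

(* A monic polynomial of degree n with zero constant term is encoded by its
   coefficients of X^1, ..., X^(n-1): the ordinal i stands for X^(i+1). *)
Definition coefs n := {ffun 'I_n.-1 -> F}.

Definition poly_of n (c : coefs n) : {poly F} :=
  'X^n + \sum_(i < n.-1) c i *: 'X^(i.+1).

Definition code n (f : {poly F}) : coefs n := [ffun i : 'I_n.-1 => f`_i.+1].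

Lemma card_coefs n : #|{: coefs n}| = (q ^ n.-1)%N.
Proof. by rewrite card_ffun card_ord. Qed.

Lemma coef_poly_of n (c : coefs n) (i : 'I_n.-1) : (poly_of c)`_i.+1 = c i.
Proof.
rewrite coefD coefXn ltn_eqF ?add0r; last by case: i => /= i; lia.
rewrite coef_sum (bigD1 i) //= coefZ coefXn eqxx mulr1 big1 ?addr0 // => j ji.
by rewrite coefZ coefXn eqSS eq_sym (negPf (_ : (j : nat) != i)) ?mulr0.
Qed.

Lemma poly_ofK n (c : coefs n) : code n (poly_of c) = c.
Proof. by apply/ffunP => i; rewrite ffunE coef_poly_of. Qed.

Lemma poly_of_inj n : injective (@poly_of n).
Proof. exact: can_inj (@poly_ofK n). Qed.

Lemma monorig_poly_of n (c : coefs n) : (0 < n)%N -> monorig n (poly_of c).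
Proof.
move=> n0; have ss : (size (\sum_(i < n.-1) c i *: 'X^(i.+1))%R < size ('X^n : {poly F}))%N.
  rewrite size_polyXn ltnS; apply: leq_trans (size_sum _ _ _) _.
  apply/bigmax_leqP => i _; apply: leq_trans (size_scale_leq _ _) _.
  by rewrite size_polyXn; case: i => /= i; lia.
apply/monorigP; split.
- by rewrite monicE lead_coefDl // lead_coefXn.
- by rewrite size_polyDl // size_polyXn.
- rewrite coefD coefXn ltn_eqF // add0r coef_sum big1 // => i _.
  by rewrite coefZ coefXn mulr0.
Qed.

Lemma codeK n (f : {poly F}) : (0 < n)%N -> monorig n f -> poly_of (code n f) = f.
Proof.
move=> n0 mf; have mc := monorig_poly_of (code n f) n0.
apply/polyP => -[|i].
  by case/monorigP: mf => _ _ ->; case/monorigP: mc => _ _ ->.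
have [lt|] := ltnP i n.-1.
  by have := coef_poly_of (code n f) (Ordinal lt); rewrite ffunE.
rewrite leq_eqVlt => /orP[/eqP<-|lt].
  by rewrite prednK // !monorig_coefn.
have ni : (n < i.+1)%N by lia.
by case/monorigP: mf => _ sf _; case/monorigP: mc => _ sc _; rewrite !nth_default ?sf ?sc.
Qed.

Lemma card_family_prod n (P : 'I_n -> pred F) : #|family P| = (\prod_i #|P i|)%N.
Proof. by rewrite card_family foldrE big_map enumT. Qed.

Lemma card_coefs_neq0 n j : (0 < j < n)%N ->
  #|[set c : coefs n | (poly_of c)`_j != 0]| = (q.-1 * q ^ (n - 2))%N.
Proof.
case: j => // j /= jn; have jn' : (j < n.-1)%N by lia.
pose P (i : 'I_n.-1) : pred F := if i == Ordinal jn' then predC1 0 else predT.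
transitivity #|family P|.
  apply: eq_card => c; rewrite inE (coef_poly_of c (Ordinal jn')).
  apply/idP/familyP => [cj i|/(_ (Ordinal jn'))]; last by rewrite /P eqxx.
  by rewrite /P; case: eqP => [->|].
rewrite card_family_prod (bigD1 (Ordinal jn')) //= /P eqxx cardC1.
rewrite (eq_bigr (fun=> q)) => [|i /negPf ->]; last by [].
by rewrite prod_nat_const cardC1 card_ord; congr (_ * _ ^ _)%N; lia.
Qed.

Lemma card_coefs_eq0_neq0 n i j : (0 < i < n)%N -> (0 < j < n)%N -> i != j ->
  #|[set c : coefs n | ((poly_of c)`_i == 0) && ((poly_of c)`_j != 0)]|
    = (q.-1 * q ^ (n - 3))%N.
Proof.
case: i => // i /= iN; case: j => // j /= jN; rewrite eqSS => ij.
have iN' : (i < n.-1)%N by lia. have jN' : (j < n.-1)%N by lia.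
pose oi := Ordinal iN'; pose oj := Ordinal jN'.
have oij : oj != oi by rewrite -val_eqE /= eq_sym.
pose P (k : 'I_n.-1) : pred F :=
  if k == oi then pred1 0 else if k == oj then predC1 0 else predT.
transitivity #|family P|.
  apply: eq_card => c; rewrite inE (coef_poly_of c oi) (coef_poly_of c oj).
  apply/andP/familyP => [[ci cj] k|H].
    by rewrite /P; case: eqP => [->|_] //; case: eqP => [->|].
  have := H oi; have := H oj; rewrite /P eqxx (negPf oij) eqxx.
  by rewrite !inE.
rewrite card_family_prod (bigD1 oi) //= (bigD1 oj) //= /P !eqxx (negPf oij) card1 cardC1.
rewrite (eq_bigr (fun=> q)) => [|k /andP[/negPf -> /negPf ->]]; last by [].
rewrite prod_nat_const mul1n; congr (_ * _ ^ _)%N.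
have := cardsC (oi |: [set oj]); rewrite cardsU1 inE eq_sym oij cards1 card_ord.
have -> : #|~: (oi |: [set oj])| = #|[pred k | (k != oi) && (k != oj)]|.
  by apply: eq_card => k; rewrite !inE negb_or.
by move=> e; rewrite -[LHS](addKn (true + 1)%N) e; lia.
Qed.

Definition compose d k n (gh : coefs k * coefs n) : coefs d :=
  code d (poly_of gh.1 \Po poly_of gh.2).

Lemma poly_of_compose d k n (gh : coefs k * coefs n) : (0 < k)%N -> (0 < n)%N ->
  d = (k * n)%N -> poly_of (compose d gh) = poly_of gh.1 \Po poly_of gh.2.
Proof.
move=> k0 n0 ->; rewrite codeK ?muln_gt0 ?k0 //.
by apply: monorig_comp; rewrite ?monorig_poly_of.
Qed.

Definition composites d k : {set coefs d} :=
  [set compose d gh | gh in [set: coefs k * coefs (d %/ k)]].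

Lemma compositesP d k n f : (0 < k)%N -> (0 < n)%N -> d = (k * n)%N ->
  reflect (exists gh : coefs k * coefs n, poly_of f = poly_of gh.1 \Po poly_of gh.2)
    (f \in composites d k).
Proof.
move=> k0 n0 dE; have dn : (d %/ k)%N = n by rewrite dE mulKn.
rewrite /composites dn.
apply: (iffP imsetP) => [[gh _ ->]|[gh E]]; first by exists gh; rewrite poly_of_compose.
by exists gh => //; apply: poly_of_inj; rewrite E poly_of_compose.
Qed.

Lemma card_composites_leq d k :
  (#|composites d k| <= q ^ (k.-1 + (d %/ k).-1))%N.
Proof.
apply: leq_trans (leq_imset_card _ _) _.
by rewrite cardsT card_prod !card_coefs expnD.
Qed.

End MonicOriginal.

(** * Sizes of the sets of compositions and of their intersections *)

Section CountingComposites.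
Variables (F : finFieldType) (p : nat).
Hypothesis chp : p \in [pchar F].
Local Notation q := #|F|.
Implicit Types (n k d l m : nat).

Lemma card_composites_tame k n : (0 < k)%N -> (0 < n)%N -> ~~ (p %| k)%N ->
  #|composites F (k * n) k| = (q ^ (k.-1 + n.-1))%N.
Proof.
move=> k0 n0 pk; rewrite card_imset; last first.
  rewrite mulKn // => -[g h] [g' h'] /(congr1 (@poly_of _ _)).
  rewrite !poly_of_compose //= => E.
  have kn : k%:R != 0 :> F by rewrite (natr_neq0 chp).
  have [] := tame_uniq n0 kn (monorig_poly_of g k0) (monorig_poly_of h n0)
    (monorig_poly_of h' n0) E.
  by move=> /poly_of_inj -> /poly_of_inj ->.
by rewrite cardsT card_prod !card_coefs mulKn // expnD.
Qed.

(** By [collision_determined], a collision is fixed by its two inner polynomials, with n-1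
    coefficients each, and by the k/p - 1 coefficients of the first outer polynomial at positive
    multiples of p below k. *)
Lemma card_composites_collisions k n : (0 < k)%N -> (0 < n)%N -> (p %| k)%N ->
  (2 * q ^ (k.-1 + n.-1) <=
   2 * #|composites F (k * n) k| + q ^ (n.-1 + n.-1 + (k %/ p).-1))%N.
Proof.
move=> k0 n0 pk; rewrite /composites mulKn //.
have := card_collisions (@compose F (k * n) k n) [set: _].
rewrite cardsT card_prod !card_coefs -expnD => /leq_trans; apply.
rewrite leq_add2l.
pose W := (coefs F n * coefs F n * coefs F (k %/ p))%type.
have -> : (q ^ (n.-1 + n.-1 + (k %/ p).-1))%N = #|{: W}|.
  by rewrite !card_prod !card_coefs -!expnD.
pose phi (xy : (coefs F k * coefs F n) * (coefs F k * coefs F n)) : W :=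
  (xy.1.2, xy.2.2, [ffun i : 'I_((k %/ p).-1) => (poly_of xy.1.1)`_(p * i.+1)]).
set coll := [set xy | _].
have <- : #|phi @: coll| = #|coll|; last by rewrite max_card.
have comp_inj h : injective (fun g : coefs F k => poly_of g \Po poly_of (h : coefs F n)).
  move=> g g' /comp_poly_inj E; apply: poly_of_inj; apply: E.
  by case/monorigP: (monorig_poly_of h n0) => _ -> _; rewrite ltnS.
apply: card_in_imset => -[[g1 h1] [g1' h1']] [[g2 h2] [g2' h2']].
rewrite !inE /= => /andP[ne1 /eqP/(congr1 (@poly_of _ _)) E1].
move=> /andP[_ /eqP/(congr1 (@poly_of _ _)) E2] [e1 e2 /ffunP C].
rewrite !poly_of_compose //= in E1 E2; subst h2 h2'.
have hne : h1 != h1'.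
  apply: contra ne1 => /eqP hh; rewrite -hh in E1 *.
  by rewrite (comp_inj h1 g1 g1' E1).
have gg : g1 = g2.
  apply: poly_of_inj.
  apply: (collision_determined chp n0 (monorig_poly_of h1 n0) (monorig_poly_of h1' n0)
    _ (monorig_poly_of g1 k0) (monorig_poly_of g2 k0) E1 E2).
    by apply: contra hne => /eqP/poly_of_inj ->.
  move=> i /andP[i0 ik] pi.
  have p0 : (0 < p)%N by rewrite prime_gt0 // (pcharf_prime chp).
  have [t tE] : exists t, i = (p * t.+1)%N.
    by case/dvdnP: pi i0 => -[|t] ->; [rewrite mul0n | exists t; rewrite mulnC].
  have tk : (t < (k %/ p).-1)%N.
    have : (t.+1 < k %/ p)%N.
      by rewrite -(ltn_pmul2l p0) -tE mulnC divnK.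
    by lia.
  by have := C (Ordinal tk); rewrite !ffunE -tE.
rewrite -gg; congr (_, (_, _)); apply: (comp_inj h1').
by rewrite -E1 -E2 gg.
Qed.

(** By [two_sided_determined] with t = m/l, an element is coded by the inner polynomial of degree l,
    the t coefficients of [g] just below its leading one, and the coefficients of [G] at 1, ...,
    l-2. *)
Lemma card_composites_inter l m : (1 < l)%N -> (l <= m)%N -> ~~ (p %| l)%N ->
  (#|composites F (l * m) l :&: composites F (l * m) m|
     <= q ^ (l.-1 + m %/ l + (l - 2)))%N.
Proof.
move=> l1 lm pl.
have l0 : (0 < l)%N by lia. have m0 : (0 < m)%N by lia.
pose t := (m %/ l)%N.
pose W := (coefs F l * {ffun 'I_t -> F} * {ffun 'I_(l - 2) -> F})%type.
have -> : (q ^ (l.-1 + m %/ l + (l - 2)))%N = #|{: W}|.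
  by rewrite !card_prod !card_coefs !card_ffun !card_ord -!expnD.
pose r (f : coefs F (l * m)) (w : W) : Prop := exists g h G H,
  [/\ poly_of f = poly_of (g : coefs F m) \Po poly_of (h : coefs F l),
      poly_of f = poly_of (G : coefs F l) \Po poly_of (H : coefs F m) &
      w = (h, [ffun i : 'I_t => (poly_of g)`_(m - i.+1)],
        [ffun i : 'I_(l - 2) => (poly_of G)`_i.+1])].
apply: (@leq_card_rel _ _ _ r) => [f|f1 f2 w _ _].
  rewrite inE => /andP[/(compositesP f l0 m0 (erefl _)) [[G H] /= E]].
  move=> /(compositesP f m0 l0 (mulnC _ _)) [[g h] /= E'].
  by eexists; exists g, h, G, H.
move=> [g1 [h1 [G1 [H1 [E1 E1' ->]]]]] [g2 [h2 [G2 [H2 [E2 E2' [eh /ffunP Cg /ffunP CG]]]]]].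
apply: poly_of_inj; subst h2; rewrite E1 E2.
have tm : (t < m)%N by rewrite ltn_Pdiv.
apply: (@two_sided_determined _ l m t _ _ _ (poly_of G1) (poly_of G2)
  (poly_of H1) (poly_of H2)); rewrite ?monorig_poly_of //.
- by rewrite mulnC -ltn_divLR.
- by rewrite (natr_neq0 chp).
- by rewrite -E1 E1'.
- by rewrite -E2 E2'.
- move=> i; have [im|mi _] := ltnP i m; last first.
    move: mi; rewrite leq_eqVlt => /orP[/eqP <-|mi].
      by rewrite !(monorig_coefn (monorig_poly_of _ m0)).
    case/monorigP: (monorig_poly_of g1 m0) => _ s1 _.
    case/monorigP: (monorig_poly_of g2 m0) => _ s2 _.
    by rewrite !nth_default ?s1 ?s2.
  move=> mti; have lt : (m - i.+1 < t)%N by lia.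
  have := Cg (Ordinal lt); rewrite !ffunE /=.
  by have -> : (m - (m - i.+1).+1 = i)%N by lia.
- case=> // i /andP[_ il]; have lt : (i < l - 2)%N by lia.
  by have := CG (Ordinal lt); rewrite !ffunE.
Qed.

Definition wild_pairs m : {set coefs F p * coefs F m} :=
  setX [set g | (poly_of g)`_p.-1 != 0] [set h | (poly_of h)`_m.-1 != 0].

Lemma card_wild_pairs m : (p < m)%N ->
  #|wild_pairs m| = (q.-1 * q ^ (p - 2) * (q.-1 * q ^ (m - 2)))%N.
Proof.
have p1 := prime_gt1 (pcharf_prime chp) => pm.
by rewrite cardsX !card_coefs_neq0 //; lia.
Qed.

Lemma card_wild_image m : (p < m)%N -> (odd p -> odd m) ->
  #|@compose F (p * m) p m @: wild_pairs m| =
    (q.-1 * q ^ (p - 2) * (q.-1 * q ^ (m - 2)))%N.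
Proof.
move=> pm om; rewrite -card_wild_pairs //; apply: card_in_imset => -[g h] [g' h'].
have p0 := prime_gt0 (pcharf_prime chp).
have m0 : (0 < m)%N by lia.
rewrite !inE /= => /andP[c b] _ /(congr1 (@poly_of _ _)).
rewrite !poly_of_compose //= => E.
have [] := wild_uniq chp pm om _ _ _ _ c b E; rewrite ?monorig_poly_of //.
by move=> /poly_of_inj -> /poly_of_inj ->.
Qed.

Lemma wild_image_sub m : (p < m)%N ->
  @compose F (p * m) p m @: wild_pairs m \subset composites F (p * m) p.
Proof.
move=> pm; have p0 := prime_gt0 (pcharf_prime chp).
by rewrite /composites mulKn // imsetS // subsetT.
Qed.

Lemma wild_interP m f : (p < m)%N ->
  f \in @compose F (p * m) p m @: wild_pairs m ->
  f \in composites F (p * m) m ->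
  exists gh : coefs F m * coefs F p,
  [/\ poly_of f = poly_of gh.1 \Po poly_of gh.2, (p %| m)%N, ~~ (p %| m %/ p)%N &
   gh \in setX [set g | ((poly_of g)`_m.-1 == 0) && ((poly_of g)`_(m - m %/ p) != 0)]
       [set h | (poly_of h)`_p.-1 != 0]].
Proof.
move=> pm; have p0 := prime_gt0 (pcharf_prime chp).
have m0 : (0 < m)%N by lia.
case/imsetP => -[g h]; rewrite inE /= !inE => /andP[c b] E.
have {E} : poly_of f = poly_of g \Po poly_of h by rewrite E poly_of_compose.
move=> E /(compositesP f m0 p0 (mulnC _ _)) [[g2 h2] /= E2].
exists (g2, h2); rewrite !inE /=.
have [-> -> -> -> ->] := wild_two_sided chp pm (monorig_poly_of g p0)
  (monorig_poly_of h m0) c b (monorig_poly_of g2 m0) (monorig_poly_of h2 p0)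
  (etrans (esym E) E2).
by rewrite eqxx.
Qed.

(** By [wild_interP], a value of a wild pair can have outer degree m as well only if p divides m
    exactly once; otherwise the two families are disjoint. *)
Lemma card_wild_disjoint m : (p < m)%N -> (odd p -> odd m) ->
  ~~ [&& p %| m & ~~ (p %| m %/ p)]%N ->
  (#|composites F (p * m) m| + q.-1 * q ^ (p - 2) * (q.-1 * q ^ (m - 2)) <=
   #|composites F (p * m) p :|: composites F (p * m) m|)%N.
Proof.
move=> pm om no; rewrite -card_wild_image // addnC -cardsUI.
rewrite (_ : _ :&: _ = set0) ?cards0 ?addn0; last first.
  apply/setP => f; rewrite !inE; apply/negP => /andP[f1 f2].
  case: (wild_interP pm f1 f2) => gh [_ a b _].
  by move: no; rewrite a b.
by apply: subset_leq_card; apply: setSU; apply: wild_image_sub.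
Qed.

(** The correction term counts the pairs of [wild_interP]: the outer polynomial has a prescribed
    zero and a prescribed nonzero coefficient, the inner one a prescribed nonzero coefficient. *)
Lemma card_wild_overlap m : (p < m)%N -> (odd p -> odd m) ->
  (#|composites F (p * m) m| + q.-1 * q ^ (p - 2) * (q.-1 * q ^ (m - 2)) <=
   #|composites F (p * m) p :|: composites F (p * m) m| +
   q.-1 * q ^ (m - 3) * (q.-1 * q ^ (p - 2)))%N.
Proof.
move=> pm om; rewrite -card_wild_image // addnC -cardsUI.
have p1 := prime_gt1 (pcharf_prime chp).
apply: leq_add; first by apply: subset_leq_card; apply: setSU; apply: wild_image_sub.
case: (boolP (p %| m)%N) => [pdm|npm]; last first.
  rewrite (_ : _ :&: _ = set0) ?cards0 //.
  apply/setP => f; rewrite !inE; apply/negP => /andP[f1 f2].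
  case: (wild_interP pm f1 f2) => gh [_ a b _].
  by move: npm; rewrite a.
have tm := divnK pdm; set t := (m %/ p)%N in tm.
(* This separates the index m-t of the nonzero coefficient from the index m-1 of the zero one. *)
have t1 : (1 < t)%N by move: pm; rewrite -tm -{1}(mul1n p) ltn_pmul2r //; lia.
have tm' : (t < m)%N by rewrite ltn_Pdiv //; lia.
rewrite -(@card_coefs_eq0_neq0 F m m.-1 (m - t)); try lia.
rewrite -(@card_coefs_neq0 F p p.-1); last by lia.
rewrite -cardsX; apply: leq_trans (leq_imset_card (fun gh => code (p * m) (poly_of gh.1 \Po poly_of gh.2)) _).
apply: subset_leq_card; apply/subsetP => f; rewrite inE => /andP[f1 f2].
case: (wild_interP pm f1 f2) => gh [E _ _ ghP].
by apply/imsetP; exists gh => //; rewrite -E poly_ofK.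
Qed.

End CountingComposites.

(** * From decomposable polynomials to monic original ones *)

Section Normalization.
Variable F : finFieldType.
Local Notation q := #|F|.
Implicit Types (n k d : nat).

Definition monic_decomposables d : {set coefs F d} :=
  \bigcup_(k < d | (1 < k)%N && (k %| d)%N) composites F d k.

Lemma card_monic_decomposables_leq d :
  (#|monic_decomposables d| <=
    \sum_(k < d | (1 < k)%N && (k %| d)%N) q ^ (k.-1 + (d %/ k).-1))%N.
Proof.
rewrite /monic_decomposables.
elim/big_ind2: _ => [|A a B b lA lB|k _]; first by rewrite cards0.
  by rewrite (leq_trans _ (leq_add lA lB)) // -cardsUI leq_addr.
exact: card_composites_leq.
Qed.

Lemma composites_sub_decomposables d k : (1 < k)%N -> (k < d)%N -> (k %| d)%N ->
  composites F d k \subset monic_decomposables d.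
Proof.
by move=> k1 kd pk; apply: (bigcup_sup (Ordinal kd)) => /=; rewrite ?k1 ?pk.
Qed.

Lemma monorig_normalize n (f : {poly F}) : (0 < n)%N -> size f = n.+1 ->
  monorig n ((lead_coef f)^-1 *: (f - (f`_0)%:P)).
Proof.
move=> n0 sf; have l0 : lead_coef f != 0 by rewrite lead_coef_eq0 -size_poly_eq0 sf.
have sg : size (f - (f`_0)%:P) = n.+1.
  by rewrite size_polyDl ?sf // size_polyN (leq_ltn_trans (size_polyC_leq1 _)).
apply/monorigP; split.
- rewrite monicE lead_coefZ lead_coefDl ?mulVf // sf size_polyN.
  by rewrite (leq_ltn_trans (size_polyC_leq1 _)).
- by rewrite size_scale ?invr_eq0.
- by rewrite coefZ coefB coefC eqxx subrr mulr0.
Qed.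

(** The affine part [w] of [h] moves to the outer polynomial: [h = w \Po h0] gives
    [f = (g \Po w) \Po h0]. Normalizing [g \Po w] then leaves just the scalar and the constant term
    of [f]. *)
Lemma decomposable_normalize d (f : {poly F}) : (1 < d)%N -> size f = d.+1 ->
  decomposable f ->
  exists2 c, c \in monic_decomposables d & f = lead_coef f *: poly_of c + (f`_0)%:P.
Proof.
move=> d1 sf [g [h [sg [sh E]]]].
set k := (size g).-1; set n := (size h).-1.
have k1 : (1 < k)%N by rewrite /k -ltnS prednK // ltnW // ltnW.
have n1 : (1 < n)%N by rewrite /n -ltnS prednK // ltnW // ltnW.
have sgk : size g = k.+1 by rewrite /k prednK // ltnW // ltnW.
have shn : size h = n.+1 by rewrite /n prednK // ltnW // ltnW.
have dE : d = (k * n)%N by rewrite -size_comp_poly -E sf.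
have l0 : lead_coef h != 0 by rewrite lead_coef_eq0 -size_poly_eq0 shn.
have a0 : lead_coef f != 0 by rewrite lead_coef_eq0 -size_poly_eq0 sf.
set h0 := (lead_coef h)^-1 *: (h - (h`_0)%:P).
pose w : {poly F} := lead_coef h *: 'X + (h`_0)%:P.
have mh0 : monorig n h0 by apply: monorig_normalize => //; lia.
have hE : h = w \Po h0.
  rewrite /w comp_polyD comp_polyZ comp_polyX comp_polyC /h0 scalerA mulfV //.
  by rewrite scale1r subrK.
have sw : size w = 2.
  by rewrite size_polyDl ?size_scale ?size_polyX // (leq_ltn_trans (size_polyC_leq1 _)).
set g1 := g \Po w.
have sg1 : size g1 = k.+1 by rewrite size_comp_poly2.
have E1 : f = g1 \Po h0 by rewrite E hE comp_polyA.
set g0 := (lead_coef g1)^-1 *: (g1 - (g1`_0)%:P).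
have mg0 : monorig k g0 by apply: monorig_normalize => //; lia.
have la : lead_coef f = lead_coef g1.
  case/monorigP: mh0 => /eqP mh0 s0 _.
  by rewrite E1 lead_coef_comp ?mh0 ?expr1n ?mulr1 // s0; lia.
have l1 : lead_coef g1 != 0 by rewrite -la.
have c0 : f`_0 = g1`_0.
  case/monorigP: mh0 => _ _ z; rewrite E1 -horner_coef0 horner_comp.
  by rewrite (horner_coef0 h0) z horner_coef0.
have m0 : monorig (k * n) (g0 \Po h0) by apply: monorig_comp => //; lia.
have k0 : (0 < k)%N by lia. have n0 : (0 < n)%N by lia.
have pE : poly_of (code d (g0 \Po h0)) = g0 \Po h0.
  by rewrite codeK -?dE // ?dE //; lia.
exists (code d (g0 \Po h0)).
  have kd : (k < d)%N by rewrite dE -{1}(muln1 k) ltn_pmul2l.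
  have kdv : (k %| d)%N by rewrite dE dvdn_mulr.
  apply: (subsetP (composites_sub_decomposables k1 kd kdv)).
  apply/(compositesP _ k0 n0 dE); exists (code k g0, code n h0).
  by rewrite pE /= !codeK.
rewrite pE la c0 /g0 comp_polyZ scalerA mulfV // scale1r comp_polyB comp_polyC.
by rewrite -E1 subrK.
Qed.

Lemma poly_of_coefsK d (c : {ffun 'I_d.+1 -> F}) (i : 'I_d.+1) :
  (poly_of_coefs c)`_i = c i.
Proof. by rewrite coef_poly ltn_ord inord_val. Qed.

(** In a f + b the scalar a is the coefficient at d and b is the one at 0, so triples correspond
    bijectively to decomposable polynomials. *)
Lemma card_Dd d : (1 < d)%N -> #|Dd F d| = (q.-1 * q * #|monic_decomposables d|)%N.
Proof.
move=> d1; have d0 : (0 < d)%N by lia.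
pose X : {set F * F * coefs F d} := setX (setX [set~ 0] [set: F]) (monic_decomposables d).
pose pol (t : F * F * coefs F d) : {poly F} := t.1.1 *: poly_of t.2 + (t.1.2)%:P.
pose phi (t : F * F * coefs F d) : {ffun 'I_d.+1 -> F} := [ffun i : 'I_d.+1 => (pol t)`_i].
have spol t : t.1.1 != 0 -> size (pol t) = d.+1.
  move=> a0; have [_ sc _] := monorigP _ _ (monorig_poly_of t.2 d0).
  by rewrite size_polyDl size_scale // ?sc // (leq_ltn_trans (size_polyC_leq1 _)).
have polK t : t.1.1 != 0 -> poly_of_coefs (phi t) = pol t.
  move=> a0; apply/polyP => i; have [id|di] := ltnP i d.+1.
    by rewrite (poly_of_coefsK (phi t) (Ordinal id)) ffunE.
  by rewrite coef_poly ltnNge di nth_default // spol.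
have <- : #|X| = (q.-1 * q * #|monic_decomposables d|)%N.
  by rewrite !cardsX cardsT cardsC1.
have -> : Dd F d = phi @: X.
  apply/setP => c; rewrite inE; apply/andP/imsetP.
    case=> /eqP sc /asboolP dc.
    have [f fD fE] := decomposable_normalize d1 sc dc.
    exists (lead_coef (poly_of_coefs c), (poly_of_coefs c)`_0, f).
      by rewrite !inE fD lead_coef_eq0 -size_poly_eq0 sc.
    by apply/ffunP => i; rewrite ffunE /pol /= -fE poly_of_coefsK.
  case=> -[[a b] f]; rewrite !inE andbT /= => /andP[a0 fD] ->.
  rewrite polK // spol //; split=> //; apply/asboolP.
  case/bigcupP: fD => k /andP[k1 kd].
  have k0 : (0 < k)%N by lia.
  have dE : (d = k * (d %/ k))%N by rewrite mulnC divnK.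
  have n1 : (1 < d %/ k)%N by rewrite ltn_divRL // mul1n.
  have n0 : (0 < d %/ k)%N by lia.
  move=> /(compositesP f k0 n0 dE)[[g h] /= fE].
  have [_ sg _] := monorigP _ _ (monorig_poly_of g k0).
  have [_ sh _] := monorigP _ _ (monorig_poly_of h n0).
  exists (a *: poly_of g + b%:P), (poly_of h).
  rewrite size_polyDl size_scale // ?sg ?sh ?(leq_ltn_trans (size_polyC_leq1 _)) //.
  by rewrite /pol /= fE [RHS]comp_polyD comp_polyZ comp_polyC.
apply: card_in_imset => -[[a b] f] [[a' b'] f'].
rewrite !inE !andbT /= => /andP[a0 _] /andP[a0' _] /(congr1 (@poly_of_coefs F d)).
rewrite !polK // /pol /= => E.
have mf := monorig_poly_of f d0; have mf' := monorig_poly_of f' d0.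
have ea : a = a'.
  have := congr1 (fun g : {poly F} => g`_d) E.
  by rewrite !coefD !coefZ !coefC !monorig_coefn // !gtn_eqF // !addr0 !mulr1.
have eb : b = b'.
  have := congr1 (fun g : {poly F} => g`_0) E.
  case/monorigP: mf => _ _ z; case/monorigP: mf' => _ _ z'.
  by rewrite !coefD !coefZ !coefC z z' !eqxx !mulr0 !add0r.
move: E; rewrite -ea -eb => /addIr/(scalerI a0)/poly_of_inj ->.
by [].
Qed.

End Normalization.

(** * Numerical estimates *)

Section DivisorSum.
Local Open Scope nat_scope.
Implicit Types (q l m k n x y E : nat).

Lemma geometric_leq q n : 1 < q -> \sum_(i < n) q ^ i <= q ^ n.
Proof.
move=> q1; elim: n => [|n IH]; first by rewrite big_ord0.
rewrite big_ord_recr /= expnS (leq_trans (leq_add IH (leqnn _))) //.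
by rewrite addnn -mul2n leq_mul2r q1 orbT.
Qed.

(** Distinct exponents below [E] make this a partial sum of the geometric series. *)
Lemma sum_expn_inj (I : finType) (A : {set I}) (e : I -> nat) q E : 1 < q ->
  {in A &, injective e} -> (forall i, i \in A -> e i < E) ->
  \sum_(i in A) q ^ e i <= q ^ E.
Proof.
move=> q1 inj; case: E => [|E] eE.
  by rewrite big1 // => i /eE.
apply: leq_trans (geometric_leq E.+1 q1).
pose e' i : 'I_E.+1 := inord (e i).
have e'E i : i \in A -> e' i = e i :> nat by move=> /eE iE; rewrite inordK.
have inj' : {in A &, injective e'}.
  by move=> i j iA jA /(congr1 val); rewrite /= !e'E //; apply: inj.
have -> : \sum_(i in A) q ^ e i = \sum_(j in e' @: A) q ^ j.
  by rewrite big_imset //=; apply: eq_bigr => i /e'E ->.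
by rewrite [leqRHS](bigID (mem (e' @: A))) /= leq_addr.
Qed.

(** Sum and product determine an ordered pair. Applied to k and d/k, this makes the exponent k-1 +
    d/k-1 injective on the divisors with k <= d/k. *)
Lemma sum_prod_eq a b c d : a + b = c + d -> a * b = c * d -> a <= b -> c <= d -> a = c.
Proof.
move=> s pr ab cd; case: (ltngtP a c) => // lt; exfalso.
  have : (c - a) * (b - c) = 0 by nia.
  by nia.
have : (a - c) * (d - a) = 0 by nia.
by nia.
Qed.

Lemma add_predn_inj a b c d : 0 < a -> 0 < b -> 0 < c -> 0 < d ->
  a.-1 + b.-1 = c.-1 + d.-1 -> a + b = c + d.
Proof. by lia. Qed.

(* With x = k - l and y = k' - l one has l (l + m - k - k') = x y; the bound then
   fails only for l = 2 and d = 12, 16, 18. *)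
Lemma middle_divisor_exponent l m k k' : 1 < l -> k * k' = l * m -> l < k -> l < k' ->
  (2 < l -> l.+1 < k /\ l.+1 < k') -> (l * l <= k) || (l * l <= k') ->
  [&& l * m != 12, l * m != 16 & l * m != 18] ->
  3 * l * (k.-1 + k'.-1).+1 + m <= 3 * l * (l + m - 2).
Proof.
move=> l1 kk lk lk' l3 ll sp.
wlog: k k' kk lk lk' l3 ll / l * l <= k' => [W|ll'].
  case/orP: (ll) => ll2; last exact: W.
  rewrite (addnC k.-1); apply: (W k' k) => //; first by rewrite mulnC.
    by move=> /l3 [].
  by rewrite orbC.
have [x kE] : exists x, k = l + x by exists (k - l); lia.
have [y kE'] : exists y, k' = l + y by exists (k' - l); lia.
(* Multiplied by l, the goal amounts to this inequality, since l (l + m - k - k') = x y. *)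
have main : 4 * l * l + l * (x + y) <= (3 * l - 1) * (x * y).
  have [l2|l2] := leqP l 2.
    have {}l2 : l = 2 by lia.
    subst l; rewrite kE kE' in kk lk lk' ll'.
    have x1 : 0 < x by lia. have y2 : 2 <= y by lia.
    have pr : x * y + 2 * (x + y) + 4 = 2 * m by nia.
    have [x3|x3] := leqP 3 x; first by nia.
    have [xE|xE] : x = 1 \/ x = 2 by lia.
      by subst x; move: sp; rewrite -kk; lia.
    by subst x; move: sp; rewrite -kk; lia.
  have [x2 _] := l3 l2.
  have {}x2 : 2 <= x by lia.
  have [c lE] : exists c, l = c + 3 by exists (l - 3); lia.
  have [u xE] : exists u, x = u + 2 by exists (x - 2); lia.
  have [z yE] : exists z, y = l * (c + 2) + z.
    exists (y - l * (c + 2)); rewrite subnKC //.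
    by move: ll'; rewrite kE' -[X in _ <= X + _](muln1 l) -leq_subLR -mulnBr lE; lia.
  have -> : 3 * l - 1 = 3 * c + 8 by lia.
  (* With l = c+3, x = u+2 and y = l(c+2)+z, the difference of the two sides has only nonnegative
     coefficients. *)
  have <- : 4 * l * l + l * (x + y) + ((5 * c + 13) * z + l * l * (5 * c + 4) +
      u * ((3 * c + 8) * z + l * l * (3 * c + 5))) = (3 * c + 8) * (x * y).
    by rewrite xE yE lE; lia.
  exact: leq_addr.
have e : l * m = l * l + l * (x + y) + x * y by rewrite -kk kE kE'; lia.
have ek : l * (k + k') = l * l + l * l + l * (x + y) by rewrite kE kE'; lia.
have l0 : 0 < l by lia.
have s : l * (l + m - (k + k')) = x * y by rewrite mulnBr mulnDr e ek; lia.
have s0 : 0 < l + m - (k + k').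
  have : 0 < x * y by rewrite muln_gt0; lia.
  by rewrite -s muln_gt0 => /andP[].
rewrite -(leq_pmul2l l0).
have [S SE] : exists S, l + m - (k + k') = S.+1 by exists (l + m - (k + k')).-1; lia.
have e1 : (k.-1 + k'.-1).+1 + S = l + m - 2 by lia.
rewrite -e1 [3 * l * (_ + _)]mulnDr mulnDr mulnDr leq_add2l.
have -> : l * (3 * l * S) = 3 * l * (x * y) - 3 * l * l by rewrite -s SE; lia.
by rewrite e; move: main; rewrite mulnBl mul1n; lia.
Qed.

(** The terms k = l and k = m give the main part. The condition on E reads E <= l+m-2 - d/(3l^2)
    with d = l m. The remaining divisors fall into the classes k <= d/k and k > d/k; outside the
    exceptional d, each class has distinct exponents below E and so contributes at most q^E. *)
Lemma divisor_sum_leq q l m : 1 < q -> prime l -> l < m ->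
  (forall k, 1 < k -> k %| l * m -> l <= k) ->
  exists2 E, 3 * l * E + m <= 3 * l * (l + m - 2) &
    \sum_(k < l * m | (1 < k) && (k %| l * m)) q ^ (k.-1 + (l * m %/ k).-1)
      <= 2 * q ^ (l + m - 2) + 2 * q ^ E.
Proof.
move=> q1 pl lm minl; have l1 := prime_gt1 pl.
have [sp|sp] := boolP [&& l * m != 12, l * m != 16 & l * m != 18]; last first.
  have l2 : l = 2.
    apply/eqP; rewrite eqn_leq l1 andbT; apply: minl => //.
    by move: sp; rewrite !negb_and !negbK => /or3P[] /eqP ->.
  subst l; clear pl minl l1.
  have mE : m = 6 \/ m = 8 \/ m = 9 by lia.
  (* The exact exponent of the middle divisors: 3 and 4 of 12, then 4 of 16, then 3 and 6 of 18. *)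
  pose e := if m == 6 then 5 else if m == 8 then 6 else 7.
  exists e; first by rewrite /e; case: mE => [->|[->|->]].
  rewrite /e; case: mE => [->|[->|->]] /=.
  - rewrite -(big_mkord (fun k => (1 < k) && (k %| 2 * 6)) (fun k => q ^ (k.-1 + (2 * 6 %/ k).-1))).
    rewrite big_mkcond /index_iota /= !big_cons big_nil /=.
    rewrite -[1 + 5]/6 -[2 + 3]/5 -[3 + 2]/5 -[5 + 1]/6 -[2 + 6 - 2]/6.
    by move: (q ^ 6) (q ^ 5); lia.
  - rewrite -(big_mkord (fun k => (1 < k) && (k %| 2 * 8)) (fun k => q ^ (k.-1 + (2 * 8 %/ k).-1))).
    rewrite big_mkcond /index_iota /= !big_cons big_nil /=.
    rewrite -[1 + 7]/8 -[3 + 3]/6 -[7 + 1]/8 -[2 + 8 - 2]/8.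
    by move: (q ^ 8) (q ^ 6); lia.
  - rewrite -(big_mkord (fun k => (1 < k) && (k %| 2 * 9)) (fun k => q ^ (k.-1 + (2 * 9 %/ k).-1))).
    rewrite big_mkcond /index_iota /= !big_cons big_nil /=.
    rewrite -[1 + 8]/9 -[2 + 5]/7 -[5 + 2]/7 -[8 + 1]/9 -[2 + 9 - 2]/9.
    by move: (q ^ 9) (q ^ 7); lia.
pose d := l * m; rewrite -/d.
have d0 : 0 < d by rewrite /d; nia.
have ld : l < d by rewrite /d; nia.
have md : m < d by rewrite /d; nia.
have hm : m <= 3 * l * (l + m - 2).
  have : 1 * (l + m - 2) <= 3 * l * (l + m - 2) by rewrite leq_mul2r; lia.
  by lia.
exists ((3 * l * (l + m - 2) - m) %/ (3 * l)).
  by rewrite addnC -leq_subRL // [3 * l * (_ %/ _)]mulnC leq_trunc_div.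
set E := _ %/ _.
pose ol := Ordinal ld; pose om := Ordinal md.
have lmo : om != ol by rewrite -val_eqE /= gtn_eqF.
rewrite (bigD1 ol) /=; last by rewrite l1 dvdn_mulr.
rewrite (bigD1 om) /=; last by rewrite dvdn_mull // lmo !andbT; lia.
have -> : l.-1 + (d %/ l).-1 = l + m - 2 by rewrite /d mulKn; lia.
have -> : m.-1 + (d %/ m).-1 = l + m - 2 by rewrite /d mulnK; lia.
rewrite addnA addnn -mul2n leq_add2l.
pose P (k : 'I_d) := [&& 1 < k, k %| d, k != ol & k != om].
pose e (k : 'I_d) := k.-1 + (d %/ k).-1.
have PE (k : 'I_d) : P k -> [/\ k * (d %/ k) = d, 0 < k, 0 < d %/ k & e k < E].
  case/and4P => k1 kd; rewrite -!val_eqE /= => kl km.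
  have k0 : 0 < k by lia.
  have kk : k * (d %/ k) = d by rewrite mulnC divnK.
  have k'1 : 1 < d %/ k by rewrite ltn_divRL // mul1n.
  have k'd : d %/ k %| d by apply/dvdnP; exists k; rewrite kk.
  have lk : l < k by rewrite ltn_neqAle eq_sym kl minl.
  have lk' : l < d %/ k.
    rewrite ltn_neqAle minl // andbT; apply: contra km => /eqP lE.
    have kE : k * l = l * m := etrans (congr1 (muln k) lE) kk.
    by move/eqP: kE; rewrite mulnC eqn_pmul2l // ltnW.
  split => //; first by lia.
  (* For odd l, 2 would be a smaller divisor of d, so d is odd and the even number l+1 does not
     divide it. *)
  have npar j : 2 < l -> l < j -> j %| d -> l.+1 < j.
    move=> l2 lj jd; rewrite ltn_neqAle lj andbT; apply/eqP => jE.
    have : 2 %| d.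
      apply: dvdn_trans jd; rewrite -jE dvdn2 /=.
      by case: (even_prime pl) l2 => [->|->].
    by move=> /(minl 2 isT); rewrite leqNgt l2.
  (* The cofactor j/l is a divisor of d greater than 1, hence at least l. *)
  have sq j : l < j -> j %| d -> l %| j -> l * l <= j.
    move=> lj jd /dvdnP[c jE]; rewrite jE leq_mul2r; apply/orP; right.
    apply: minl; first by move: lj; rewrite jE -{1}(mul1n l) ltn_pmul2r // ltnW.
    by apply: dvdn_trans jd; rewrite jE dvdn_mulr.
  have ll : (l * l <= k) || (l * l <= d %/ k).
    have : l %| k * (d %/ k) by rewrite kk dvdn_mulr.
    rewrite Euclid_dvdM // => /orP[/(sq _ lk kd) ->|/(sq _ lk' k'd) ->] //.
    by rewrite orbT.
  have := middle_divisor_exponent l1 kk lk lk' (fun h => conj (npar _ h lk kd) (npar _ h lk' k'd)) ll sp.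
  rewrite /E leq_divRL; last by rewrite muln_gt0 /= (ltnW l1).
  by rewrite /e mulnC => le; rewrite leq_subRL // addnC.
rewrite (eq_bigl P) => [|k]; last by rewrite /P -!andbA.
have inj (b : bool) : {in [set k | P k && ((k <= d %/ k) == b)] &, injective e}.
  move=> i j; rewrite !inE => /andP[/PE[di i0 i0' _] bi] /andP[/PE[dj j0 j0' _] bj] eij.
  apply: val_inj => /=.
  have sE : i + d %/ i = j + d %/ j by apply: add_predn_inj eij.
  case: b bi bj => /eqP bi /eqP bj.
    by apply: (sum_prod_eq sE) => //; rewrite di dj.
  suff dd : d %/ i = d %/ j by move: sE; rewrite dd => /addIn.
  apply: (@sum_prod_eq _ i _ j); rewrite ?[_ * nat_of_ord _]mulnC ?di ?dj //.
  - by rewrite addnC sE addnC.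
  - by rewrite ltnW // ltnNge bi.
  - by rewrite ltnW // ltnNge bj.
have bnd (b : bool) : \sum_(k in [set k | P k && ((k <= d %/ k) == b)]) q ^ e k <= q ^ E.
  apply: sum_expn_inj => // k; rewrite inE => /andP[/PE[]] //.
rewrite (bigID (fun k : 'I_d => k <= d %/ k)) /= mul2n -addnn leq_add //.
  apply: leq_trans (bnd true); rewrite leq_eqVlt; apply/orP; left; apply/eqP.
  by apply: eq_bigl => k; rewrite !inE eqb_id.
apply: leq_trans (bnd false); rewrite leq_eqVlt; apply/orP; left; apply/eqP.
by apply: eq_bigl => k; rewrite !inE eqbF_neg.
Qed.

End DivisorSum.

(** * Cases according to the characteristic and the least prime divisor *)

Section LeastPrimeDivisor.
Variables (F : finFieldType) (p l m : nat).
Hypotheses (chp : p \in [pchar F]) (pl : prime l) (lm : (l <= m)%N).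
Hypothesis minl : forall k, (1 < k)%N -> (k %| l * m)%N -> (l <= k)%N.
Local Notation q := #|F|.
Local Notation D := #|monic_decomposables F (l * m)|.
Local Notation Q := (q ^ (l.-1 + m.-1))%N.
Local Notation M := (q ^ (l - 2) * q ^ (m - 2))%N.

Let l1 : (1 < l)%N := prime_gt1 pl.
Let m1 : (1 < m)%N := leq_trans l1 lm.
Let q1 : (1 < q)%N := card_finRing_gt1 F.
Let l0 : (0 < l)%N := ltnW l1.
Let m0 : (0 < m)%N := ltnW m1.
Let q0 : (0 < q)%N := ltnW q1.

Let QM : Q = (q * q * M)%N.
Proof.
rewrite -mulnA -expnD -!expnS; congr (_ ^ _)%N.
by move: l1 m1; clear; lia.
Qed.

Lemma outer_least_sub : composites F (l * m) l \subset monic_decomposables F (l * m).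
Proof.
apply: composites_sub_decomposables => //; last by rewrite dvdn_mulr.
by rewrite -{1}(muln1 l) ltn_pmul2l.
Qed.

Lemma inner_least_sub : composites F (l * m) m \subset monic_decomposables F (l * m).
Proof.
apply: composites_sub_decomposables => //; last by rewrite dvdn_mull.
by rewrite -{1}(mul1n m) ltn_pmul2r.
Qed.

Lemma two_outer_leq :
  (#|composites F (l * m) l :|: composites F (l * m) m| <= D)%N.
Proof. by apply: subset_leq_card; rewrite subUset outer_least_sub inner_least_sub. Qed.

Lemma card_inner_least_tame : ~~ (p %| m)%N -> #|composites F (l * m) m| = Q.
Proof. by move=> pm; rewrite (mulnC l) (card_composites_tame chp) // addnC. Qed.

Lemma card_inner_least_wild : (p %| m)%N ->
  (2 * Q <= 2 * #|composites F (l * m) m| + q ^ (l.-1 + l.-1 + (m %/ p).-1))%N.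
Proof.
move=> pm; have := card_composites_collisions chp m0 l0 pm.
by rewrite (mulnC m) (addnC m.-1).
Qed.

(** For a proper divisor k > 1, both k and d/k are at least l while their product is l^2, so k = l
    is the only term of the sum. *)
Lemma square_upper : l = m -> (D <= Q)%N.
Proof.
move=> elm; apply: leq_trans (card_monic_decomposables_leq _ _) _.
have ld : (l < l * m)%N by rewrite -{1}(muln1 l) ltn_pmul2l.
rewrite (bigD1 (Ordinal ld)) /=; last by rewrite l1 dvdn_mulr.
rewrite mulKn // big1 ?addn0 // => k /andP[/andP[k1 kd]].
rewrite -val_eqE /= => kl; exfalso.
have kk : (k * (l * m %/ k) = l * m)%N by rewrite mulnC divnK.
have k'1 : (1 < l * m %/ k)%N by rewrite ltn_divRL // mul1n.
have lk := minl k1 kd.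
have lk' : (l <= l * m %/ k)%N.
  by apply: minl => //; apply/dvdnP; exists k; rewrite kk.
have kl' : (l < k)%N by rewrite ltn_neqAle eq_sym kl.
have : (l * m < k * (l * m %/ k))%N.
  apply: (@leq_ltn_trans (l * l)); first by rewrite leq_mul2l elm leqnn orbT.
  by apply: (@leq_trans (k * l)); rewrite ?ltn_pmul2r // leq_mul2l lk' orbT.
by rewrite kk ltnn.
Qed.

Lemma upper : (l < m)%N -> exists2 E, (3 * l * E + m <= 3 * l * (l.-1 + m.-1))%N &
  (D <= 2 * Q + 2 * q ^ E)%N.
Proof.
move=> ltlm; have [E leE sE] := divisor_sum_leq q1 pl ltlm minl.
have e : (l + m - 2 = l.-1 + m.-1)%N by move: l1 m1; clear; lia.
rewrite e in leE sE; exists E => //.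
exact: leq_trans (card_monic_decomposables_leq _ _) sE.
Qed.

(** * The characteristic differs from the least prime divisor *)

Section Tame.
Hypothesis npl : p <> l.

Let pndl : ~~ (p %| l)%N.
Proof. by rewrite dvdn_prime2 ?(pcharf_prime chp) //; apply/eqP. Qed.

Lemma tame_lower : (Q <= D)%N.
Proof.
rewrite -(card_composites_tame chp l0 m0 pndl).
exact: subset_leq_card outer_least_sub.
Qed.

Lemma tame_union : (Q + #|composites F (l * m) m| <= D + q ^ (l.-1 + m %/ l + (l - 2)))%N.
Proof.
rewrite -{1}(card_composites_tame chp l0 m0 pndl) -cardsUI leq_add ?two_outer_leq //.
by have I := card_composites_inter chp l1 lm pndl; exact: I.
Qed.

(** Divided by q, this is D >= 2Q(1 - 2/q). The intersection of the two families has at most Q/q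
    elements. If p divides m, then p > l, and the collisions for outer degree m also number at most
    Q/q. *)
Lemma tame_lower2 : (l < m)%N -> (2 * q * Q <= q * D + 4 * Q)%N.
Proof.
move=> ltlm; have U := tame_union.
have Yq : (q * q ^ (l.-1 + m %/ l + (l - 2)) <= Q)%N.
  rewrite -expnS leq_exp2l //.
  have := divn_eq m l; have := ltn_pmod m l0; move: (m %/ l)%N (m %% l)%N => a r.
  by move: l1 ltlm; clear; case: a => [|[|a]]; nia.
have Xq : exists2 X, (q * X <= Q)%N & (2 * Q <= 2 * #|composites F (l * m) m| + X)%N.
  have [pm|pm] := boolP (p %| m)%N; last by exists 0%N; rewrite ?muln0 ?card_inner_least_tame ?addn0.
  exists (q ^ (l.-1 + l.-1 + (m %/ p).-1))%N; last exact: card_inner_least_wild.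
  rewrite -expnS leq_exp2l //.
  have lp : (l < p)%N.
    rewrite ltn_neqAle eq_sym; apply/andP; split; first exact/eqP.
    by apply: minl; rewrite ?dvdn_mull // prime_gt1 // (pcharf_prime chp).
  have := divnK pm; move: (m %/ p)%N => t; move: l1 m1 lp; clear.
  by case: t => [|t]; nia.
case: Xq => X Xq cX.
have U2 : (q * (Q + #|composites F (l * m) m|) <= q * (D + q ^ (l.-1 + m %/ l + (l - 2))))%N.
  by rewrite leq_mul2l U orbT.
have cX2 : (q * (2 * Q) <= q * (2 * #|composites F (l * m) m| + X))%N.
  by rewrite leq_mul2l cX orbT.
move: U2 cX2 Yq Xq; rewrite !mulnDr.
move: #|composites F _ m| D Q (q ^ (l.-1 + _ + _))%N => I N K Y; clear.
lia.
Qed.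

(** Both families have full size Q here, so only their intersection is lost, and its exponent meets
    the bound required of E. *)
Lemma tame_lower5 : (l < m)%N -> ~~ (p %| m)%N -> exists2 E,
  (3 * l * E + m <= 3 * l * (l.-1 + m.-1))%N & (2 * Q <= D + q ^ E)%N.
Proof.
move=> ltlm pm; exists (l.-1 + m %/ l + (l - 2))%N; last first.
  by have := tame_union; rewrite card_inner_least_tame // addnn -mul2n.
have := divn_eq m l; have := ltn_pmod m l0; move: (m %/ l)%N (m %% l)%N => a r.
move: l1 ltlm; clear => l1 ltlm rl mE.
have [c lE] : exists c, l = (c + 2)%N by exists (l - 2)%N; lia.
case: a mE => [|[|a]] mE; first by lia.
  by subst l; nia.
by subst l m; nia.
Qed.

End Tame.

(** * The characteristic is the least prime divisor *)

Section Wild.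
Hypothesis pEl : p = l.

Let odd_pm : odd p -> odd m.
Proof.
rewrite pEl => ol; apply/negPn/negP; rewrite -dvdn2 => m2.
have : (l <= 2)%N by apply: minl => //; rewrite dvdn_mull.
by move: l1 ol; case: (l) => [|[|[|?]]].
Qed.

(** For outer and inner degree p, the collision bound is q^(2(p-1)) = Q, so at least half of the
    pairs survive. *)
Lemma wild_square_lower : l = m -> (Q <= 2 * D)%N.
Proof.
move=> elm; have pm : (p %| m)%N by rewrite pEl elm.
have ml : ((m %/ l).-1 = 0)%N by rewrite -elm divnn l0.
have ll : (l.-1 + l.-1 = l.-1 + m.-1)%N by rewrite -elm.
have := card_inner_least_wild pm; rewrite pEl ml addn0 ll.
have := subset_leq_card inner_least_sub.
by move: #|composites F _ m| D Q => I N K; clear; lia.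
Qed.

(** The disjoint families give D >= I + (q-1)^2 M, where Q = q^2 M and I counts outer degree m.
    Either p does not divide m and I = Q, or p^2 divides m and I >= Q - Q/(2q); in the latter case
    the bound Q is attained by this estimate at q = 2. *)
Lemma wild_lower : (l < m)%N ->
  ~~ ((p %| m)%N && ~~ (p %| m %/ p)%N) ->
  (Q <= D)%N /\ (2 * q * Q <= q * D + 4 * Q)%N.
Proof.
move=> ltlm ns; have U := @card_wild_disjoint F p chp m.
rewrite pEl in U; have {}U := leq_trans (U ltlm _ _) two_outer_leq.
have {U} U : (#|composites F (l * m) m| + q.-1 * q.-1 * M <= D)%N.
  apply: leq_trans (U _ _); rewrite -?pEl //.
  by rewrite leq_eqVlt; apply/orP; left; apply/eqP; ring.
(* With q = c+2 the claims are polynomial in c. The products named below serve [lia] as nonnegative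
   atoms, and the hypotheses multiplied by c are supplied by hand. *)
have [c qE] : exists c, q = c.+2 by exists (q - 2)%N; move: q1; clear; lia.
rewrite QM; move: U; have [pm|pm] := boolP (p %| m)%N; last first.
  rewrite card_inner_least_tame // QM; move: D M => N K; rewrite qE /=; clear => U.
  have [K1 E1] : exists K1, K1 = (c * K)%N by eexists.
  have [K2 E2] : exists K2, K2 = (c * (c * K))%N by eexists.
  have [K3 E3] : exists K3, K3 = (c * (c * (c * K)))%N by eexists.
  have U2 : (c * (c.+2 * c.+2 * K + c.+1 * c.+1 * K) <= c * N)%N by rewrite leq_mul2l U orbT.
  split; lia.
have := card_inner_least_wild pm.
have : (q * q ^ (l.-1 + l.-1 + (m %/ p).-1) <= Q)%N.
  rewrite -expnS leq_exp2l //.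
  have := divnK pm; rewrite pEl; have := dvdn_leq m0 pm.
  have : (l %| m %/ l)%N by move: ns; rewrite pEl -{1}pEl pm negbK.
  case/dvdnP => s ->; move: l1 ltlm; clear => l1 ltlm _ mE.
  have [a aE] : exists a, l = (a + 2)%N by exists (l - 2)%N; lia.
  by subst l m; case: s ltlm => [|s] ltlm; lia.
rewrite QM; move: #|composites F _ m| D M (q ^ (_ + _))%N => I N K X; rewrite qE /=; clear => X1 X2 U.
have [K1 E1] : exists K1, K1 = (c * K)%N by eexists.
have [K2 E2] : exists K2, K2 = (c * (c * K))%N by eexists.
have [K3 E3] : exists K3, K3 = (c * (c * (c * K)))%N by eexists.
have U2 : (c * (I + c.+1 * c.+1 * K) <= c * N)%N by rewrite leq_mul2l U orbT.
have X3 : (c * (2 * (c.+2 * c.+2 * K)) <= c * (2 * I + X))%N by rewrite leq_mul2l X2 orbT.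
split; last by lia.
by rewrite -(leq_pmul2l (ltn0Sn c.+1)); lia.
Qed.

(** This is D >= (3 - 2/q)Q/2. Of the (q-1)^2 M wild values at most a fraction 1/q also have outer
    degree m, and the collisions for outer degree m number at most M = Q/q^2. *)
Lemma wild_special_lower : (l < m)%N -> (p %| m)%N -> ~~ (p %| m %/ p)%N ->
  (3 * q * Q <= 2 * q * D + 2 * Q)%N.
Proof.
move=> ltlm pm pmp; have U := @card_wild_overlap F p chp m.
rewrite pEl in U; have {}U := leq_trans (U ltlm _) (leq_add two_outer_leq (leqnn _)).
have mq : (q * (q.-1 * q ^ (m - 3) * (q.-1 * q ^ (l - 2))) = q.-1 * q.-1 * M)%N.
  have -> : (m - 2 = (m - 3).+1)%N by move: l1 ltlm; clear; lia.
  by rewrite expnS; ring.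
have {U} U : (q * #|composites F (l * m) m| + q * (q.-1 * q.-1 * M) <= q * D + q.-1 * q.-1 * M)%N.
  rewrite -{2}mq -!mulnDr leq_mul2l; apply/orP; right.
  apply: leq_trans (U _); rewrite -?pEl //.
  by rewrite leq_eqVlt; apply/orP; left; apply/eqP; ring.
have [c qE] : exists c, q = c.+2 by exists (q - 2)%N; move: q1; clear; lia.
have := card_inner_least_wild pm.
have : (q ^ (l.-1 + l.-1 + (m %/ p).-1) <= M)%N.
  rewrite -expnD leq_exp2l //.
  (* If m/l were 2, then m would be even, so l = p = 2 and p would divide m/p. Hence m/l >= 3, as
     the exponent comparison requires. *)
  have : (m %/ l != 2)%N.
    apply/negP => /eqP t2; have m2 : (2 %| m)%N by rewrite -(divnK pm) pEl t2 dvdn_mulr.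
    have : (l <= 2)%N by apply: minl => //; rewrite dvdn_mull.
    move=> l2; have lE : l = 2%N by move: l1 l2; clear; lia.
    by move: pmp; rewrite pEl t2 lE.
  have := divnK pm; rewrite pEl; move: (m %/ l)%N => t; move: l1 ltlm; clear.
  move=> l1 ltlm mE; have [a aE] : exists a, l = (a + 2)%N by exists (l - 2)%N; lia.
  by subst l m; case: t ltlm => [|[|[|t]]] // ltlm _; lia.
rewrite QM; move: U; move: #|composites F _ m| D M (q ^ (_ + _))%N => I N K X; rewrite qE /=; clear => U X1 X2.
have [K1 E1] : exists K1, K1 = (c * K)%N by eexists.
have [K2 E2] : exists K2, K2 = (c * (c * K))%N by eexists.
have [K3 E3] : exists K3, K3 = (c * (c * (c * K)))%N by eexists.
have X3 : (c * (2 * (c.+2 * c.+2 * K)) <= c * (2 * I + X))%N by rewrite leq_mul2l X2 orbT.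
have X4 : (c * X <= c * K)%N by rewrite leq_mul2l X1 orbT.
lia.
Qed.

End Wild.
End LeastPrimeDivisor.

(** * Estimates with real exponents *)

Section RealEstimates.
Variable R : realType.
Implicit Types (q : R) (l m A B : nat).

(** The hypothesis says A <= B - m/(3l), and m/(3l) = lm/(3l^2). *)
Lemma exprn_leq_powR q l m A B : 1 <= q -> (0 < l)%N ->
  (3 * l * A + m <= 3 * l * B)%N ->
  q ^+ A <= q ^+ B * q `^ (- ((l * m)%N%:R / (3 * l%:R ^+ 2))).
Proof.
move=> q1 l0 le; have q0 : 0 < q := lt_le_trans ltr01 q1.
rewrite -(powR_mulrn A) ?(ltW q0) // -(powR_mulrn B) ?(ltW q0) // -powRD; last by rewrite (gt_eqF q0) implybT.
apply: ler_powR => //.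
have lR : 0 < l%:R :> R by rewrite ltr0n.
have -> : (l * m)%N%:R / (3 * l%:R ^+ 2) = m%:R / (3 * l%:R) :> R.
  by rewrite natrM; field; rewrite (gt_eqF lR).
rewrite lerBrDr -(ler_pM2l (_ : 0 < 3 * l%:R)); last by rewrite mulr_gt0.
rewrite mulrDr mulrCA divff ?mulr1; last by rewrite mulf_neq0 ?gt_eqF.
by rewrite -!natrM -natrD ler_nat.
Qed.

(** The inequality of arithmetic and geometric means for l and m. *)
Lemma powR_sqrt_leq q l m : 1 <= q ->
  q `^ (2 * Num.sqrt (l * m)%N%:R) <= q ^+ (l + m).
Proof.
move=> q1; rewrite -powR_mulrn ?(le_trans ler01) //; apply: ler_powR => //.
rewrite -ler_pdivlMl // mulrC.
have lm0 : 0 <= (l + m)%N%:R / 2 :> R by rewrite divr_ge0 ?ler0n.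
rewrite -[leRHS](ger0_norm lm0) -sqrtr_sqr ler_sqrt; last by rewrite sqr_ge0.
rewrite natrM natrD -subr_ge0.
have -> : ((l%:R + m%:R) / 2) ^+ 2 - l%:R * m%:R = ((l%:R - m%:R) / 2) ^+ 2 :> R by field.
exact: sqr_ge0.
Qed.

(** On exponents this is (l-2)(m-2) >= 0. *)
Lemma exprn_add_leq_powR q l m : 1 <= q -> (1 < l)%N -> (1 < m)%N ->
  q ^+ (l + m) <= q `^ ((l * m)%N%:R / 2 + 2).
Proof.
move=> q1 l1 m1; rewrite -powR_mulrn ?(le_trans ler01) //; apply: ler_powR => //.
rewrite natrD natrM.
have l2 : 0 <= l%:R - 2 :> R by rewrite subr_ge0 (ler_nat _ 2).
have m2 : 0 <= m%:R - 2 :> R by rewrite subr_ge0 (ler_nat _ 2).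
by have := mulr_ge0 l2 m2; lra.
Qed.

End RealEstimates.

(** * Combination of the cases *)

Section Assembly.
Variable R : realFieldType.
Implicit Types (q P Q c x e pa pb : R).

(** Here x counts the monic original compositions. The flags stand for d = l^2 ([sq]), p different
    from l ([tame]), p = l dividing d exactly twice ([sp]), and p not dividing d ([tm]). *)
Lemma combine_bounds q Q x e (sq tame sp tm : bool) :
  2 <= q -> 0 < Q -> 0 <= e ->
  (tame -> Q <= x) -> (sq -> Q <= 2 * x) -> (sq -> x <= Q) ->
  (~~ sq -> x <= 2 * Q + 2 * (Q * e)) ->
  (~~ sq -> sp -> (3 - 2 * q^-1) * (2 * Q) / 4 <= x) ->
  (~~ sq -> ~~ sp -> Q <= x /\ 2 * Q * (1 - 2 * q^-1) <= x) ->
  (~~ sq -> tm -> 2 * Q <= x + Q * e) ->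
  (tm -> tame) -> (sq -> ~~ sp -> tame) ->
  let c : R := if sq then 1 else 2 in
  [/\ c * Q / 2 <= x, x <= c * Q * (1 + e),
      (sq -> tame) -> 6 <= q -> (3 - 2 * q^-1) * (c * Q) / 4 <= x,
      ~~ sp -> c * Q * (1 - 2 * q^-1) <= x &
      tm -> `|x - c * Q| <= c * Q * e].
Proof.
move=> q2 Q0 e0 + + + + + + + + +.
have q0 : 0 < q by lra.
have uQ : 0 < q^-1 * Q by rewrite mulr_gt0 ?invr_gt0.
have uQ2 : q^-1 * Q <= 2^-1 * Q by rewrite ler_pM2r // lef_pV2 ?posrE.
have uQ6 : 6 <= q -> q^-1 * Q <= 6^-1 * Q.
  by move=> q6; rewrite ler_pM2r // lef_pV2 ?posrE.
have Qe : 0 <= Q * e by rewrite mulr_ge0 // ltW.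
case: sq => /= t1 t2 t3 t4 t5 t6 t7 t8 t9.
  have {}t2 := t2 isT; have {}t3 := t3 isT; clear t4 t5 t6 t7; split.
  - by lra.
  - by lra.
  - by move=> /(_ isT)/t1 ? _; lra.
  - by move=> /(t9 isT)/t1; lra.
  - by move=> /t8/t1 Qx; rewrite ler_norml; apply/andP; split; lra.
have {}t4 := t4 isT; have {}t5 := t5 isT; have {}t6 := t6 isT; have {}t7 := t7 isT.
clear t2 t3 t9; split.
- by case: sp t5 t6 => [/(_ isT) + _|_ /(_ isT)[+ _]]; lra.
- by lra.
- by move=> _ /uQ6 {}uQ6; case: sp t5 t6 => [/(_ isT) + _|_ /(_ isT)[_ +]]; lra.
- by move=> /t6[].
- by move=> /t7 t; rewrite ler_norml; apply/andP; split; lra.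
Qed.

(** Multiplication by q(q-1) passes from monic original polynomials to all of degree d. P is
    q^(l+m), enclosed by [pa] = q^(2 sqrt d) and [pb] = q^(d/2+2). *)
Lemma scale_bounds q P Q c x e pa pb (nsq nspecial tm : Prop) :
  2 <= q -> 0 < Q -> P = q ^+ 2 * Q -> 1 <= c -> c <= 2 -> pa <= P -> P <= pb ->
  e < 1 ->
  [/\ c * Q / 2 <= x, x <= c * Q * (1 + e),
      nsq -> 6 <= q -> (3 - 2 * q^-1) * (c * Q) / 4 <= x,
      nspecial -> c * Q * (1 - 2 * q^-1) <= x &
      tm -> `|x - c * Q| <= c * Q * e] ->
  let K := q * (q - 1) in let a := K * (c * Q) in let N := K * x in
  (pa / 2 <= a /\ a < 2 * pb) /\
  (a / 2 <= N /\ N <= a * (1 + e) /\ a * (1 + e) < 2 * a /\ 2 * a < 4 * pb) /\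
  (nsq -> 6 <= q ->
     (3 - 2 * q^-1) * a / 4 <= N /\ pa / 2 <= (3 - 2 * q^-1) * a / 4) /\
  (nspecial -> a * (1 - 2 * q^-1) <= N) /\
  (tm -> `|N - a| <= a * e).
Proof.
move=> q2 Q0 PE c1 c2 PA PB e1 F K a N.
have q0 : 0 < q by lra.
have K0 : 0 < K by rewrite mulr_gt0 //; lra.
have KQ0 : 0 < K * Q by rewrite mulr_gt0.
have KQ : K * Q = P * (1 - q^-1) by rewrite PE /K; field; rewrite gt_eqF.
have P0 : 0 < P by rewrite PE mulr_gt0 // exprn_gt0.
have uP : 0 < q^-1 * P by rewrite mulr_gt0 // invr_gt0.
have uP2 : q^-1 * P <= 2^-1 * P by rewrite ler_pM2r // lef_pV2 ?posrE.
have a1 : K * Q <= a by rewrite /a mulrCA ler_peMl // ltW.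
have a2 : a <= 2 * (K * Q) by rewrite /a mulrCA ler_pM2r.
case: F => F1 F2 F3 F4 F5.
have {}F1 : a / 2 <= N by rewrite /a /N -mulrA ler_pM2l.
have {}F2 : N <= a * (1 + e) by rewrite /a /N -mulrA ler_pM2l.
have {}F3 : nsq -> 6 <= q -> (3 - 2 * q^-1) * a / 4 <= N.
  move=> s q6; have -> : (3 - 2 * q^-1) * a / 4 = K * ((3 - 2 * q^-1) * (c * Q) / 4).
    by rewrite /a; ring.
  by rewrite ler_pM2l // F3.
have {}F4 : nspecial -> a * (1 - 2 * q^-1) <= N.
  by move=> /F4; rewrite /a /N -(mulrA K) ler_pM2l.
have {}F5 : tm -> `|N - a| <= a * e.
  by move=> /F5; rewrite /a /N -mulrBr normrM (gtr0_norm K0) -(mulrA K) ler_pM2l.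
clearbody a N K.
have a0 : 0 < a by lra.
have ae : a * e < a by rewrite -[ltRHS]mulr1 ltr_pM2l.
split; first by split; lra.
split; first by do 3?split; lra.
split=> // s q6; split; first exact: F3.
have uP6 : q^-1 * P <= 6^-1 * P by rewrite ler_pM2r // lef_pV2 ?posrE //; lra.
have u6 : q^-1 <= 6^-1 by rewrite lef_pV2 ?posrE //; lra.
(* For q >= 6 one has K Q >= 5P/6, and (8/3)(5/6)/4 = 5/9 exceeds 1/2. *)
have h1 : (3 - 2 * 6^-1) * (K * Q) <= (3 - 2 * q^-1) * a.
  by apply: ler_pM; lra.
by lra.
Qed.

End Assembly.

Theorem mainTheorem1 (R : realType) (F : finFieldType) (p d : nat) :
  p \in [pchar F] -> (2 <= d)%N -> ~~ prime d ->
  let q : R := (#|F|)%:R in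
  let l := pdiv d in
  let a : R := alpha R #|F| d in
  let N : R := (#|Dd F d|)%:R in
  let e : R := q `^ (- ((d%:R) / (3 * (l%:R) ^+ 2))) in
  (* (1) *)
  (q `^ (2 * Num.sqrt (d%:R)) / 2 <= a /\ a < 2 * q `^ ((d%:R) / 2 + 2)) /\
  (* (2) *)
  (a / 2 <= N /\ N <= a * (1 + e) /\ a * (1 + e) < 2 * a
     /\ 2 * a < 4 * q `^ ((d%:R) / 2 + 2)) /\
  (* (3) *)
  (d <> (p ^ 2)%N -> 5 < q ->
     (3 - 2 * q^-1) * a / 4 <= N /\ q `^ (2 * Num.sqrt (d%:R)) / 2 <= (3 - 2 * q^-1) * a / 4) /\
  (* (4) *)
  (~ (p = l /\ (p ^ 2 %| d)%N /\ ~~ (p ^ 3 %| d)%N) -> a * (1 - 2 * q^-1) <= N) /\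
  (* (5) *)
  (~~ (p %| d)%N -> `|N - a| <= a * e).
Proof.
move=> chp d2 npd q l a N e.
have pl : prime l by rewrite pdiv_prime.
have l1 := prime_gt1 pl; have l0 : (0 < l)%N := ltnW l1.
have minl k : (1 < k)%N -> (k %| d)%N -> (l <= k)%N by exact: pdiv_min_dvd.
pose m := (d %/ l)%N.
have dE : d = (l * m)%N by rewrite mulnC divnK // pdiv_dvd.
have lm : (l <= m)%N.
  apply: minl; last by rewrite dE dvdn_mull.
  rewrite ltn_divRL ?pdiv_dvd // mul1n ltn_neqAle pdiv_leq ?(ltnW d2) // andbT.
  by apply: contra npd => /eqP <-.
have m1 : (1 < m)%N := leq_trans l1 lm.
have dsq : (d == l ^ 2)%N = (l == m).
  by rewrite dE -mulnn eqn_pmul2l // eq_sym.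
have p1 := prime_gt1 (pcharf_prime chp).
have p2l : (p ^ 2 %| d)%N -> p = l -> (p %| m)%N.
  by move=> + pE; rewrite dE -pE -mulnn dvdn_pmul2l // ltnW.
have p3l : p = l -> (p %| m)%N -> ~~ (p %| m %/ p)%N ->
    (p ^ 2 %| d)%N /\ ~~ (p ^ 3 %| d)%N.
  move=> pE pm npm; rewrite dE -pE -mulnn expnS -mulnn !dvdn_pmul2l ?(ltnW p1) //.
  by split=> //; apply: contra npm; rewrite dvdn_divRL.
have N_E : N = q * (q - 1) * #|monic_decomposables F d|%:R.
  rewrite /N card_Dd // !natrM -subn1 natrB ?(ltnW (card_finRing_gt1 F)) //.
  by rewrite (mulrC q).
have q2 : 2 <= q by rewrite (ler_nat _ 2) card_finRing_gt1.
have q1 : 1 <= q := le_trans (ler1n _ 2) q2.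
have q0 : 0 < q := lt_le_trans ltr01 q1.
set x : R := #|monic_decomposables F d|%:R in N_E.
pose Q : R := q ^+ (l.-1 + m.-1).
have QE : (#|F| ^ (l.-1 + m.-1))%:R = Q by rewrite natrX.
have Q0 : 0 < Q by rewrite exprn_gt0.
have PE : q ^+ (l + m) = q ^+ 2 * Q.
  by rewrite -exprD; congr (_ ^+ _); move: l1 m1; clear; lia.
(* The number of distinct dominant outer degrees among l and m. *)
pose c : R := if l == m then 1 else 2.
have aE : a = q * (q - 1) * (c * Q).
  rewrite mulrCA (_ : q * (q - 1) * Q = q ^+ (l + m) * (1 - q^-1)).
    rewrite /a /alpha -/l -/m -/q dsq /c; case: eqP => [elm|_]; last by rewrite mulrA.
    by rewrite mul1r; congr (q ^+ _ * _); rewrite -elm addnn mul2n.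
  by rewrite PE; field; rewrite gt_eqF.
have PA := powR_sqrt_leq l m q1; have PB := exprn_add_leq_powR q1 l1 m1.
rewrite -dE in PA PB.
have e1 : e < 1.
  have dl : 0 < d%:R / (3 * l%:R ^+ 2) :> R.
    by rewrite divr_gt0 ?mulr_gt0 ?exprn_gt0 ?ltr0n // ltnW.
  rewrite lt_neqAle /e powR_eq1 !negb_or -leNgt (ltW q0) oppr_eq0 !gt_eqF //=.
    by rewrite -[leRHS](powRr0 q) ler_powR // oppr_le0 ltW.
  by rewrite (lt_le_trans _ q2) // ltr1n.
have e0 : 0 <= e by apply: powR_ge0.
have expE A : (3 * l * A + m <= 3 * l * (l.-1 + m.-1))%N -> (#|F| ^ A)%:R <= Q * e.
  by move=> le; rewrite natrX /e dE; apply: exprn_leq_powR.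
have minl' k : (1 < k)%N -> (k %| l * m)%N -> (l <= k)%N by rewrite -dE; apply: minl.
have XE : x = #|monic_decomposables F (l * m)|%:R by rewrite -dE.
(* The exceptional case of (4) in terms of m; it includes d = p^2, where m/p = 1. *)
pose sp := [&& p == l, p %| m & ~~ (p %| m %/ p)]%N.
have spP : ~ (p = l /\ (p ^ 2 %| d)%N /\ ~~ (p ^ 3 %| d)%N) -> ~~ sp.
  by move=> ns; apply/and3P => -[/eqP pE pm npm]; apply: ns; split; last exact: p3l.
have ltlm : l != m -> (l < m)%N by rewrite ltn_neqAle lm andbT.
have tame : p != l -> Q <= x.
  by move=> /eqP pnl; rewrite XE -QE ler_nat; exact: tame_lower chp pl lm pnl.
have half : l == m -> Q <= 2 * x.
  move=> /eqP elm; rewrite XE -QE -natrM ler_nat.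
  have [pE|/eqP pnl] := eqVneq p l; first exact: wild_square_lower chp pl lm pE elm.
  by apply: leq_trans (tame_lower chp pl lm pnl) _; rewrite mul2n -addnn leq_addr.
have upsq : l == m -> x <= Q.
  by move=> /eqP elm; rewrite XE -QE ler_nat; exact: square_upper pl lm minl' elm.
have up : l != m -> x <= 2 * Q + 2 * (Q * e).
  move=> /ltlm {}ltlm; have [A /expE leA] := upper F pl lm minl' ltlm.
  rewrite XE -(ler_nat R) natrD !natrM QE => /le_trans; apply.
  by rewrite lerD2l ler_pM2l.
have WS : l != m -> sp -> (3 - 2 * q^-1) * (2 * Q) / 4 <= x.
  move=> /ltlm {}ltlm /and3P[/eqP pE pm npm].
  have := wild_special_lower chp pl lm minl' pE ltlm pm npm.
  rewrite -(ler_nat R) natrD !natrM QE -XE -/q => h.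
  rewrite -(ler_pM2l (mulr_gt0 (ltr0n R 2) q0)).
  have -> : 2 * q * ((3 - 2 * q^-1) * (2 * Q) / 4) = 3 * q * Q - 2 * Q.
    by field; rewrite gt_eqF.
  by rewrite lerBlDr.
have NS : l != m -> ~~ sp -> Q <= x /\ 2 * Q * (1 - 2 * q^-1) <= x.
  move=> /ltlm {}ltlm ns.
  have [w1 w2] : (#|F| ^ (l.-1 + m.-1) <= #|monic_decomposables F (l * m)|)%N /\
      (2 * #|F| * #|F| ^ (l.-1 + m.-1) <=
        #|F| * #|monic_decomposables F (l * m)| + 4 * #|F| ^ (l.-1 + m.-1))%N.
    have [pE|/eqP pnl] := eqVneq p l.
      by apply: (wild_lower chp pl lm minl' pE ltlm); move: ns; rewrite /sp pE eqxx.
    by split; [exact: tame_lower chp pl lm pnl | exact: tame_lower2 chp pl lm minl' pnl ltlm].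
  split; first by rewrite XE -QE ler_nat.
  move: w2; rewrite -(ler_nat R) natrD !natrM QE -XE -/q => h.
  rewrite -(ler_pM2l q0); have -> : q * (2 * Q * (1 - 2 * q^-1)) = 2 * q * Q - 4 * Q.
    by field; rewrite gt_eqF.
  by rewrite lerBlDr.
have low5 : l != m -> ~~ (p %| d)%N -> 2 * Q <= x + Q * e.
  move=> /ltlm {}ltlm npd'.
  have pnl : p <> l by move=> pE; move: npd'; rewrite pE dE dvdn_mulr.
  have npm : ~~ (p %| m)%N by apply: contra npd' => pm; rewrite dE dvdn_mull.
  have [A /expE leA] := tame_lower5 chp pl lm pnl ltlm npm.
  rewrite -(ler_nat R) natrD natrM QE -XE => /le_trans; apply.
  by rewrite lerD2l.
have npdl : ~~ (p %| d)%N -> p != l.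
  by apply: contra => /eqP ->; rewrite dE dvdn_mulr.
have sqsp : l == m -> ~~ sp -> p != l.
  move=> /eqP elm; apply: contra => /eqP pE.
  by rewrite /sp pE -elm divnn l0 dvdnn eqxx dvdn1 gtn_eqF.
have B := combine_bounds q2 Q0 e0 tame half upsq up WS NS low5 npdl sqsp.
have [c1 c2] : 1 <= c /\ c <= 2.
  by rewrite /c; case: eqP => _; rewrite ?lexx ler1n.
have [S1 [S2 [S3 [S4 S5]]]] := scale_bounds q2 Q0 PE c1 c2 PA PB e1 B.
rewrite N_E aE; split=> //; split=> //; split; last first.
  by split; [move=> /spP/S4 | exact: S5].
(* As q is an integer, q > 5 means q >= 6; and if d = l^2, then d different from p^2 means p
   different from l. *)
move=> dp q5; apply: S3; last by rewrite (ler_nat _ 6) -(ltr_nat R).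
by move=> /eqP elm; apply/eqP => pE; apply: dp; rewrite dE -elm pE mulnn.
Qed.
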